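(* For every set $K\subset\mathbb{R}^n$ that is the support of an absolutely decaying measure there exists $\alpha=\alpha(K)>0$ such that for every $m\in\mathbb{N}$ and every $A\in\operatorname{M}_{n\times m}(\mathbb{R})$, the set $$\mathbf{Bad}_A(n,m)=\Big\{\mathbf{x}\in\mathbb{R}^n:\ \inf_{\mathbf{q}\in\mathbb{Z}^m\setminus\{0\}}\|\mathbf{q}\|^{m/n}\,d(A\mathbf{q}-\mathbf{x},\mathbb{Z}^n)>0\Big\}$$ is $\alpha$-winning on $K$.
   Context: $d$ is Euclidean distance and $d(\mathbf{v},\mathbb{Z}^n)=\min_{\mathbf{p}\in\mathbb{Z}^n}d(\mathbf{v},\mathbf{p})$. For a closed set $K\subset\mathbb{R}^n$ and $0<\alpha,\beta<1$, Schmidt's $(\alpha,\beta)$-game on $K$ with target set $S$: balls are $B(\mathbf{x},\rho)=\{\mathbf{x}'\in K: d(\mathbf{x},\mathbf{x}')\le\rho\}$ with $\mathbf{x}\in K$, $\rho>0$, and $(\mathbf{x}_2,\rho_2)\le_s(\mathbf{x}_1,\rho_1)$ means $\rho_2+d(\mathbf{x}_1,\mathbf{x}_2)\le\rho_1$. Bob picks $\omega_1=(\mathbf{x}_1,\rho_1)$; then Alice and Bob alternately pick $\omega_k'=(\mathbf{x}_k',\rho_k')\le_s\omega_k$ and $\omega_{k+1}\le_s\omega_k'$, centers in $K$, with $\rho_k'=\alpha\rho_k$, $\rho_{k+1}=\beta\rho_k'$. The nested balls intersect in one point $\mathbf{x}_\infty$; Alice wins if $\mathbf{x}_\infty\in S$.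 $S$ is $(\alpha,\beta)$-winning on $K$ if Alice has a strategy guaranteeing $\mathbf{x}_\infty\in S\cap K$, and $\alpha$-winning on $K$ if this holds for every $\beta\in(0,1)$. A locally finite Borel measure $\mu$ on $\mathbb{R}^n$ is $(C,\gamma)$-absolutely decaying ($C,\gamma>0$) if there is $\rho_0>0$ with $\mu(B(\mathbf{x},\rho)\cap\mathcal L^{(\varepsilon)})<C(\varepsilon/\rho)^\gamma\mu(B(\mathbf{x},\rho))$ for every affine hyperplane $\mathcal L$, $\mathbf{x}\in\operatorname{supp}\mu$, $0<\rho<\rho_0$, $\varepsilon>0$ (closed Euclidean balls; $\mathcal L^{(\varepsilon)}$ the closed $\varepsilon$-neighborhood of $\mathcal L$); $\mu$ is absolutely decaying if it is $(C,\gamma)$-absolutely decaying for some $C,\gamma>0$. *)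

(* Defs.v *)
From Stdlib Require Import Reals Lra List.
From Stdlib Require Fin.
Open Scope R_scope.

Fixpoint sumFin (n : nat) : (Fin.t n -> R) -> R :=
  match n return (Fin.t n -> R) -> R with
  | O => fun _ => 0
  | S m => fun f => f Fin.F1 + sumFin m (fun i => f (Fin.FS i))
  end.

Definition Vec (n : nat) := Fin.t n -> R.

Definition dist {n : nat} (x y : Vec n) : R :=
  sqrt (sumFin n (fun i => (x i - y i) ^ 2)).

Definition dot {n : nat} (a x : Vec n) : R := sumFin n (fun i => a i * x i).

Definition znorm {m : nat} (q : Fin.t m -> Z) : R :=
  sqrt (sumFin m (fun j => (IZR (q j)) ^ 2)).

Definition matZ {n m : nat} (A : Fin.t n -> Fin.t m -> R) (q : Fin.t m -> Z)
  : Vec n := fun i => sumFin m (fun j => A i j * IZR (q j)).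

(* d(v, Z^n) = min over p in Z^n of d(v,p); we use it only through
   lower bounds:  c <= d(v,Z^n)  iff  forall p, c <= d(v,p). *)
Definition dist_Zn_ge {n : nat} (v : Vec n) (c : R) : Prop :=
  forall p : Fin.t n -> Z, c <= dist v (fun i => IZR (p i)).

Definition Bad (n m : nat) (A : Fin.t n -> Fin.t m -> R) (x : Vec n) : Prop :=
  exists c : R, 0 < c /\
    forall q : Fin.t m -> Z, (exists j, q j <> 0%Z) ->
      forall p : Fin.t n -> Z,
        c <= Rpower (znorm q) (INR m / INR n) *
             dist (fun i => matZ A q i - x i) (fun i => IZR (p i)).

Definition is_open {n : nat} (U : Vec n -> Prop) : Prop :=
  forall x, U x -> exists r, 0 < r /\ forall y, dist x y < r -> U y.

Definition is_closed {n : nat} (K : Vec n -> Prop) : Prop :=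
  is_open (fun x => ~ K x).

Inductive is_borel {n : nat} : (Vec n -> Prop) -> Prop :=
  | borel_open : forall U, is_open U -> is_borel U
  | borel_compl : forall A, is_borel A -> is_borel (fun x => ~ A x)
  | borel_union : forall F : nat -> Vec n -> Prop,
      (forall k, is_borel (F k)) -> is_borel (fun x => exists k, F k x).

Inductive ER : Type := ERfin (r : R) | ERinf.

Definition ERle (a b : ER) : Prop :=
  match a, b with
  | _, ERinf => True
  | ERinf, ERfin _ => False
  | ERfin x, ERfin y => x <= y
  end.

Definition ERlt (a b : ER) : Prop :=
  match a, b with
  | ERfin x, ERfin y => x < y
  | ERfin _, ERinf => True
  | ERinf, _ => False
  end.

Definition ERplus (a b : ER) : ER :=
  match a, b with
  | ERfin x, ERfin y => ERfin (x + y)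
  | _, _ => ERinf
  end.

(* multiplication by a positive real scalar *)
Definition ERscale (c : R) (a : ER) : ER :=
  match a with ERfin x => ERfin (c * x) | ERinf => ERinf end.

Fixpoint ERpsum (f : nat -> ER) (N : nat) : ER :=
  match N with
  | O => ERfin 0
  | S N' => ERplus (ERpsum f N') (f N')
  end.

Definition is_ER_sup (P : ER -> Prop) (s : ER) : Prop :=
  (forall y, P y -> ERle y s) /\
  (forall z, (forall y, P y -> ERle y z) -> ERle s z).

(* mu is a (positive, countably additive) Borel measure on R^n;
   its values on non-Borel sets are irrelevant. *)
Definition is_borel_measure {n : nat} (mu : (Vec n -> Prop) -> ER) : Prop :=
  mu (fun _ => False) = ERfin 0 /\
  (forall A, is_borel A -> ERle (ERfin 0) (mu A)) /\
  (forall F : nat -> Vec n -> Prop,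
     (forall k, is_borel (F k)) ->
     (forall i j x, i <> j -> F i x -> F j x -> False) ->
     is_ER_sup (fun s => exists N, s = ERpsum (fun k => mu (F k)) N)
               (mu (fun x => exists k, F k x))).

Definition cball {n : nat} (x : Vec n) (rho : R) : Vec n -> Prop :=
  fun y => dist x y <= rho.

Definition locally_finite {n : nat} (mu : (Vec n -> Prop) -> ER) : Prop :=
  forall x, exists r, 0 < r /\ mu (cball x r) <> ERinf.

Definition supp {n : nat} (mu : (Vec n -> Prop) -> ER) : Vec n -> Prop :=
  fun x => forall r, 0 < r -> ERlt (ERfin 0) (mu (cball x r)).

Definition hyperplane {n : nat} (a : Vec n) (b : R) : Vec n -> Prop :=
  fun y => dot a y = b.

Definition nbhd {n : nat} (L : Vec n -> Prop) (eps : R) : Vec n -> Prop :=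
  fun y => exists z, L z /\ dist y z <= eps.

Definition abs_decaying_CG {n : nat} (mu : (Vec n -> Prop) -> ER)
  (C gam : R) : Prop :=
  exists rho0, 0 < rho0 /\
    forall (a : Vec n) (b : R), (exists i, a i <> 0) ->
    forall x, supp mu x ->
    forall rho, 0 < rho -> rho < rho0 ->
    forall eps, 0 < eps ->
      ERlt (mu (fun y => cball x rho y /\ nbhd (hyperplane a b) eps y))
           (ERscale (C * Rpower (eps / rho) gam) (mu (cball x rho))).

Definition abs_decaying {n : nat} (mu : (Vec n -> Prop) -> ER) : Prop :=
  exists C gam, 0 < C /\ 0 < gam /\ abs_decaying_CG mu C gam.

Definition Ball (n : nat) := (Vec n * R)%type.

Definition in_ball {n : nat} (K : Vec n -> Prop) (w : Ball n) (y : Vec n) : Prop :=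
  K y /\ dist (fst w) y <= snd w.

Definition ball_le {n : nat} (w2 w1 : Ball n) : Prop :=
  snd w2 + dist (fst w1) (fst w2) <= snd w1.

(* an Alice strategy maps the list of Bob's moves so far
   [omega_1; ...; omega_k] to Alice's move omega_k' *)
Definition Strategy (n : nat) := list (Ball n) -> Ball n.

Definition bob_prefix {n : nat} (b : nat -> Ball n) (k : nat) : list (Ball n) :=
  map b (seq 0 (S k)).

(* Alice's k-th move (0-indexed) against Bob's sequence b *)
Definition alice_move {n : nat} (s : Strategy n) (b : nat -> Ball n) (k : nat)
  : Ball n := s (bob_prefix b k).

Definition bob_legal {n : nat} (K : Vec n -> Prop) (beta : R) (s : Strategy n)
  (b : nat -> Ball n) (k : nat) : Prop :=
  match k with
  | O => K (fst (b O)) /\ 0 < snd (b O)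
  | S k' => K (fst (b k)) /\ snd (b k) = beta * snd (alice_move s b k')
            /\ ball_le (b k) (alice_move s b k')
  end.

Definition alice_legal {n : nat} (K : Vec n -> Prop) (alpha : R) (s : Strategy n)
  (b : nat -> Ball n) (k : nat) : Prop :=
  K (fst (alice_move s b k)) /\ snd (alice_move s b k) = alpha * snd (b k)
  /\ ball_le (alice_move s b k) (b k).

Definition ab_winning {n : nat} (K S : Vec n -> Prop) (alpha beta : R) : Prop :=
  exists s : Strategy n, forall b : nat -> Ball n,
    (forall k, (forall j, (j <= k)%nat -> bob_legal K beta s b j) ->
               alice_legal K alpha s b k) /\
    ((forall k, bob_legal K beta s b k) ->
     forall y, (forall k, in_ball K (b k) y) -> S y /\ K y).

Definition alpha_winning {n : nat} (K S : Vec n -> Prop) (alpha : R) : Prop :=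
  forall beta, 0 < beta < 1 -> ab_winning K S alpha beta.

(* Main.v *)
From Stdlib Require Import Reals Lra Lia ZArith Arith List Permutation.
From Stdlib Require Import ClassicalEpsilon IndefiniteDescription.
From Stdlib Require Import FunctionalExtensionality PropExtensionality.
From Stdlib Require Fin FinFun.
From Coquelicot Require Import Rcomplements.
Require Import Defs.
Open Scope R_scope.

(** Let [z_j] be the vector of the dyadic shell [2^(j-1) <= |y|_oo <= 2^j] of [Z^n] for which
    [A^T y] is closest to [Z^m].  By Dirichlet's theorem, for every [q] there is some [j] with [2^j]
    of order at most [|q|^(m/n)] for which [|q| d(A^T z_j, Z^m)] is small, and the identity
      [z_j . x - (integer) = q . (A^T z_j - P) - z_j . (A q - x - p)]
    shows that [x] lies in [Bad_A] as soon as all the [z_j . x] stay a distance [delta] away from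
    the integers.

    When the ball of the game has radius [rho], Alice gives each family of hyperplanes
    [z_j . y = p], [p] an integer, that comes near the ball the weight [(2^j rho)^(-s)], where [s]
    is chosen so that weights double at each turn.  While [2^j rho] is small, at most one hyperplane
    of the family matters; since the measure of its neighbourhood is a small proportion of the
    measure of the ball, averaging over the measure produces a point of the support that is near
    hyperplanes of at most a quarter of the total weight.  The families with [2^j rho] large
    contribute at most a convergent geometric series.  So the total weight is halved at each turn,
    up to a constant, and stays bounded: every hyperplane is avoided at a scale comparable to
    [2^(-j)].  How much must be discarded at one turn does not depend on [beta], and this is why
    neither does [alpha]. *)

(** * Finite vectors and Euclidean geometry *)

Lemma sumFin_ext {n : nat} (f g : Fin.t n -> R) :
  (forall i, f i = g i) -> sumFin n f = sumFin n g.
Proof. intros Hfg; f_equal; extensionality i; apply Hfg. Qed.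

Lemma sumFin_le {n : nat} (f g : Fin.t n -> R) :
  (forall i, f i <= g i) -> sumFin n f <= sumFin n g.
Proof.
  induction n as [|n IH]; simpl; intros Hfg; [lra|].
  apply Rplus_le_compat; [apply Hfg | apply IH; intros i; apply Hfg].
Qed.

Lemma sumFin_plus {n : nat} (f g : Fin.t n -> R) :
  sumFin n (fun i => f i + g i) = sumFin n f + sumFin n g.
Proof.
  induction n as [|n IH]; simpl; [lra|].
  rewrite (IH (fun i => f (Fin.FS i)) (fun i => g (Fin.FS i))); lra.
Qed.

Lemma sumFin_scal {n : nat} (c : R) (f : Fin.t n -> R) :
  sumFin n (fun i => c * f i) = c * sumFin n f.
Proof.
  induction n as [|n IH]; simpl; [lra|].
  rewrite (IH (fun i => f (Fin.FS i))); lra.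
Qed.

Lemma sumFin_minus {n : nat} (f g : Fin.t n -> R) :
  sumFin n (fun i => f i - g i) = sumFin n f - sumFin n g.
Proof.
  induction n as [|n IH]; simpl; [lra|].
  rewrite (IH (fun i => f (Fin.FS i)) (fun i => g (Fin.FS i))); lra.
Qed.

Lemma sumFin_const (n : nat) (c : R) : sumFin n (fun _ => c) = INR n * c.
Proof.
  induction n as [|n IH]; [simpl; lra|].
  rewrite S_INR; simpl; rewrite IH; lra.
Qed.

Lemma sumFin_zero {n : nat} (f : Fin.t n -> R) : (forall i, f i = 0) -> sumFin n f = 0.
Proof.
  intros Hf; rewrite (sumFin_ext f (fun _ => 0) Hf), sumFin_const; apply Rmult_0_r.
Qed.

Lemma sumFin_nonneg {n : nat} (f : Fin.t n -> R) :
  (forall i, 0 <= f i) -> 0 <= sumFin n f.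
Proof.
  intros Hf; rewrite <- (Rmult_0_r (INR n)), <- sumFin_const; apply sumFin_le, Hf.
Qed.

Lemma sumFin_ge_term {n : nat} (f : Fin.t n -> R) (i : Fin.t n) :
  (forall j, 0 <= f j) -> f i <= sumFin n f.
Proof.
  intros Hf; induction i as [n|n i IH]; simpl.
  - pose proof (sumFin_nonneg (fun j => f (Fin.FS j)) (fun j => Hf _)); lra.
  - pose proof (IH (fun j => f (Fin.FS j)) (fun j => Hf _)); pose proof (Hf Fin.F1).
    simpl in *; lra.
Qed.

Lemma sumFin_swap {n m : nat} (f : Fin.t n -> Fin.t m -> R) :
  sumFin n (fun i => sumFin m (f i)) = sumFin m (fun j => sumFin n (fun i => f i j)).
Proof.
  induction n as [|n IH]; simpl.
  - rewrite sumFin_const; lra.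
  - rewrite (IH (fun i => f (Fin.FS i))), sumFin_plus; reflexivity.
Qed.

Definition norm {n : nat} (x : Vec n) : R := sqrt (sumFin n (fun i => x i ^ 2)).

Definition vsub {n : nat} (x y : Vec n) : Vec n := fun i => x i - y i.

Definition vscal {n : nat} (t : R) (x : Vec n) : Vec n := fun i => t * x i.

Lemma sum_squares_nonneg {n : nat} (x : Vec n) : 0 <= sumFin n (fun i => x i ^ 2).
Proof. apply sumFin_nonneg; intros i; apply pow2_ge_0. Qed.

Lemma norm_nonneg {n : nat} (x : Vec n) : 0 <= norm x.
Proof. apply sqrt_pos. Qed.

Lemma dot_self {n : nat} (x : Vec n) : dot x x = norm x * norm x.
Proof.
  unfold norm; rewrite sqrt_sqrt by apply sum_squares_nonneg.
  apply sumFin_ext; intros i; ring.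
Qed.

Lemma dot_sub_r {n : nat} (a x y : Vec n) : dot a (vsub x y) = dot a x - dot a y.
Proof. unfold dot, vsub; rewrite <- sumFin_minus; apply sumFin_ext; intros i; ring. Qed.

Lemma dot_scal_r {n : nat} (t : R) (a x : Vec n) : dot a (vscal t x) = t * dot a x.
Proof. unfold dot, vscal; rewrite <- sumFin_scal; apply sumFin_ext; intros i; ring. Qed.

Lemma dist_norm {n : nat} (x y : Vec n) : dist x y = norm (vsub x y).
Proof. reflexivity. Qed.

Lemma norm_scal {n : nat} (t : R) (x : Vec n) : norm (vscal t x) = Rabs t * norm x.
Proof.
  unfold norm; rewrite <- sqrt_Rsqr_abs, <- sqrt_mult_alt by apply Rle_0_sqr.
  f_equal; rewrite <- sumFin_scal; apply sumFin_ext; intros i; unfold vscal, Rsqr; ring.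
Qed.

Lemma norm_ge_coord {n : nat} (x : Vec n) (i : Fin.t n) : Rabs (x i) <= norm x.
Proof.
  unfold norm; rewrite <- sqrt_Rsqr_abs, Rsqr_pow2; apply sqrt_le_1_alt.
  apply (sumFin_ge_term (fun j => x j ^ 2)); intros j; apply pow2_ge_0.
Qed.

Lemma norm_le_coord {n : nat} (x : Vec n) (c : R) :
  0 <= c -> (forall i, Rabs (x i) <= c) -> norm x <= INR n * c.
Proof.
  intros Hc Hx; destruct n as [|n]; [unfold norm; simpl; rewrite sqrt_0; lra|].
  assert (Hn : 1 <= INR (S n)) by (apply (le_INR 1); lia).
  unfold norm; rewrite <- (sqrt_Rsqr (INR (S n) * c)) by nra.
  apply sqrt_le_1_alt, Rle_trans with (sumFin (S n) (fun _ => c ^ 2)).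
  - apply sumFin_le; intros i; rewrite <- (pow2_abs (x i)).
    apply pow_incr; split; [apply Rabs_pos | apply Hx].
  - rewrite sumFin_const; unfold Rsqr.
    assert (0 <= c * c) by nra; nra.
Qed.

(* The quadratic form |s x + t y|^2 is nonnegative; evaluate it where it is smallest in [s], and,
   in case [y = 0], at a second point. *)
Lemma dot_sqr_le {n : nat} (x y : Vec n) : dot x y ^ 2 <= dot x x * dot y y.
Proof.
  assert (quadratic_form_nonneg : forall s t,
            0 <= s ^ 2 * dot x x + 2 * s * t * dot x y + t ^ 2 * dot y y).
  { intros s t.
    replace (_ + _) with (sumFin n (fun i => (s * x i + t * y i) ^ 2)).
    - apply (sum_squares_nonneg (fun i => s * x i + t * y i)).
    - unfold dot; rewrite <- !sumFin_scal, <- !sumFin_plus.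
      apply sumFin_ext; intros i; ring. }
  assert (Hx : 0 <= dot x x) by (rewrite dot_self; apply Rle_0_sqr).
  assert (Hy : 0 <= dot y y) by (rewrite dot_self; apply Rle_0_sqr).
  pose proof (quadratic_form_nonneg (dot y y) (- dot x y)) as Hmin.
  pose proof (quadratic_form_nonneg (dot x y) (- (dot x x + 1))) as Hdegenerate.
  destruct Hy as [Hy|Hy]; [|rewrite <- Hy in *; nra].
  apply Rmult_le_reg_l with (dot y y); [exact Hy | nra].
Qed.

Lemma Cauchy_Schwarz {n : nat} (x y : Vec n) : Rabs (dot x y) <= norm x * norm y.
Proof.
  pose proof (norm_nonneg x); pose proof (norm_nonneg y).
  apply Rsqr_incr_0_var; [|nra].
  rewrite <- Rsqr_abs, Rsqr_pow2; unfold Rsqr.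
  replace (_ * _) with (dot x x * dot y y) by (rewrite !dot_self; ring).
  apply dot_sqr_le.
Qed.

Lemma norm_triangle {n : nat} (x y : Vec n) : norm (fun i => x i + y i) <= norm x + norm y.
Proof.
  pose proof (norm_nonneg x); pose proof (norm_nonneg y).
  apply Rsqr_incr_0_var; [unfold Rsqr|lra].
  rewrite <- dot_self.
  replace (dot _ _) with (dot x x + 2 * dot x y + dot y y).
  - rewrite !dot_self; pose proof (Cauchy_Schwarz x y) as Hxy.
    apply Rabs_le_between in Hxy; lra.
  - unfold dot; rewrite <- sumFin_scal, <- !sumFin_plus; apply sumFin_ext; intros i; ring.
Qed.

Lemma dist_triangle {n : nat} (x y z : Vec n) : dist x z <= dist x y + dist y z.
Proof.
  rewrite !dist_norm.
  replace (vsub x z) with (fun i => vsub x y i + vsub y z i)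
    by (extensionality i; unfold vsub; ring).
  apply norm_triangle.
Qed.

Lemma dist_sym {n : nat} (x y : Vec n) : dist x y = dist y x.
Proof. unfold dist; f_equal; apply sumFin_ext; intros i; ring. Qed.

Lemma dist_refl {n : nat} (x : Vec n) : dist x x = 0.
Proof.
  rewrite dist_norm; replace (vsub x x) with (vscal 0 x)
    by (extensionality i; unfold vsub, vscal; ring).
  rewrite norm_scal, Rabs_R0; ring.
Qed.

Lemma dist_nonneg {n : nat} (x y : Vec n) : 0 <= dist x y.
Proof. apply sqrt_pos. Qed.

Lemma norm_pos_nonzero {n : nat} (a : Vec n) : 0 < norm a -> exists i, a i <> 0.
Proof.
  intros Ha; apply not_all_ex_not; intros Hzero.
  assert (norm a <= INR n * 0); [|lra].
  apply norm_le_coord; [lra|]; intros i; rewrite Hzero, Rabs_R0; lra.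
Qed.

Lemma cball_subset {n : nat} (x x' y : Vec n) (r r' : R) :
  dist x x' + r' <= r -> cball x' r' y -> cball x r y.
Proof. unfold cball; pose proof (dist_triangle x x' y); lra. Qed.

Definition slab {n : nat} (a : Vec n) (b c : R) : Vec n -> Prop :=
  fun y => Rabs (dot a y - b) <= c.

Lemma slab_shift {n : nat} (a : Vec n) (b c d : R) (x y : Vec n) :
  slab a b c x -> dist x y <= d -> slab a b (c + norm a * d) y.
Proof.
  unfold slab; intros Hx Hd.
  pose proof (Cauchy_Schwarz a (vsub x y)) as Hxy.
  rewrite <- dist_norm, dot_sub_r in Hxy.
  assert (norm a * dist x y <= norm a * d)
    by (apply Rmult_le_compat_l; [apply norm_nonneg | exact Hd]).
  apply Rabs_le_between in Hx; apply Rabs_le_between in Hxy; apply Rabs_le_between; lra.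
Qed.

Lemma set_ext {T : Type} (A B : T -> Prop) : (forall x, A x <-> B x) -> A = B.
Proof. intros HAB; extensionality x; apply propositional_extensionality, HAB. Qed.

(* A point of the slab is moved along [a] to its orthogonal projection on the hyperplane. *)
Lemma nbhd_hyperplane {n : nat} (a : Vec n) (b eps : R) : 0 < norm a ->
  nbhd (hyperplane a b) eps = slab a b (eps * norm a).
Proof.
  intros Ha; apply set_ext; intros y; split.
  - intros [z [Hz Hyz]].
    replace (eps * norm a) with (0 + norm a * eps) by ring.
    apply slab_shift with z; [|rewrite dist_sym; exact Hyz].
    unfold slab; rewrite Hz, Rminus_diag, Rabs_R0; lra.
  - intros Hy; set (t := (dot a y - b) / (norm a * norm a)).
    exists (vsub y (vscal t a)); split.
    + unfold hyperplane; rewrite dot_sub_r, dot_scal_r, dot_self; unfold t; field; lra.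
    + rewrite dist_norm.
      replace (vsub y (vsub y (vscal t a))) with (vscal t a)
        by (extensionality i; unfold vsub; ring).
      rewrite norm_scal; unfold t; rewrite Rabs_div, (Rabs_right (norm a * norm a)) by nra.
      replace (_ * norm a) with (Rabs (dot a y - b) / norm a) by (field; lra).
      apply Rle_div_l; assumption.
Qed.

Definition fcons {A : Type} {n : nat} (a : A) (f : Fin.t n -> A) (i : Fin.t (S n)) : A :=
  Fin.caseS' i (fun _ => A) a f.

Lemma fcons_eta {A : Type} {n : nat} (f : Fin.t (S n) -> A) :
  fcons (f Fin.F1) (fun i => f (Fin.FS i)) = f.
Proof. extensionality i; apply (Fin.caseS' i); reflexivity. Qed.

(** * Borel measures and their supports *)

Lemma borel_empty {n : nat} : is_borel (fun _ : Vec n => False).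
Proof. apply borel_open; intros x []. Qed.

Lemma borel_or {n : nat} (A B : Vec n -> Prop) :
  is_borel A -> is_borel B -> is_borel (fun x => A x \/ B x).
Proof.
  intros HA HB.
  replace (fun x => A x \/ B x)
    with (fun x => exists k, (match k with O => A | _ => B end) x).
  - apply borel_union; intros [|k]; assumption.
  - apply set_ext; intros x; split.
    + intros [[|k] Hx]; tauto.
    + intros [Hx|Hx]; [exists O | exists 1%nat]; exact Hx.
Qed.

Lemma borel_and {n : nat} (A B : Vec n -> Prop) :
  is_borel A -> is_borel B -> is_borel (fun x => A x /\ B x).
Proof.
  intros HA HB.
  replace (fun x => A x /\ B x) with (fun x => ~ (~ A x \/ ~ B x))
    by (apply set_ext; intros x; tauto).
  apply borel_compl, borel_or; apply borel_compl; assumption.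
Qed.

Lemma borel_diff {n : nat} (A B : Vec n -> Prop) :
  is_borel A -> is_borel B -> is_borel (fun x => A x /\ ~ B x).
Proof. intros HA HB; apply borel_and; [|apply borel_compl]; assumption. Qed.

Lemma set_guard {T : Type} (P : Prop) (A : T -> Prop) :
  (P /\ (fun x => P /\ A x) = A) \/ (fun x => P /\ A x) = (fun _ => False).
Proof.
  destruct (classic P); [left; split; [assumption|] | right]; apply set_ext; tauto.
Qed.

Lemma borel_ex_lt {n : nat} (F : nat -> Vec n -> Prop) (k : nat) :
  (forall i, is_borel (F i)) -> is_borel (fun x => exists i, (i < k)%nat /\ F i x).
Proof.
  intros HF; apply (borel_union (fun i x => (i < k)%nat /\ F i x)); intros i.
  destruct (set_guard (i < k)%nat (F i)) as [[_ ->] | ->]; auto using @borel_empty.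
Qed.

Lemma borel_closed {n : nat} (A : Vec n -> Prop) : is_closed A -> is_borel A.
Proof.
  intros HA; replace A with (fun x => ~ ~ A x) by (apply set_ext; intros x; tauto).
  apply borel_compl, borel_open, HA.
Qed.

Lemma borel_cball {n : nat} (x : Vec n) (r : R) : is_borel (cball x r).
Proof.
  apply borel_closed; intros y Hy; unfold cball in Hy.
  exists (dist x y - r); split; [lra|].
  intros z Hyz Hz; pose proof (dist_triangle x z y) as Hxy.
  unfold cball in Hz; rewrite (dist_sym z y) in Hxy; lra.
Qed.

Lemma borel_slab {n : nat} (a : Vec n) (b c : R) : is_borel (slab a b c).
Proof.
  apply borel_closed; intros y Hy; unfold slab in Hy; apply Rnot_le_lt in Hy.
  pose proof (norm_nonneg a) as Ha.
  exists ((Rabs (dot a y - b) - c) / (norm a + 1)); split; [apply Rdiv_lt_0_compat; lra|].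
  intros z Hyz Hz; apply Rlt_div_r in Hyz; [|lra].
  assert (Hy' : slab a b (c + norm a * dist y z) y)
    by (apply slab_shift with z; [exact Hz | rewrite dist_sym; apply Rle_refl]).
  unfold slab in Hy'; pose proof (dist_nonneg y z); lra.
Qed.

Lemma ERle_antisym (a b : ER) : ERle a b -> ERle b a -> a = b.
Proof. destruct a, b; simpl; intros; try tauto; f_equal; lra. Qed.

Lemma ERle_trans (a b c : ER) : ERle a b -> ERle b c -> ERle a c.
Proof. destruct a, b, c; simpl; try tauto; apply Rle_trans. Qed.

Lemma ERplus_0_r (a : ER) : ERplus a (ERfin 0) = a.
Proof. destruct a; simpl; [f_equal; ring | reflexivity]. Qed.

Lemma ERle_plus_l (a b : ER) : ERle (ERfin 0) b -> ERle a (ERplus a b).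
Proof. destruct a, b; simpl; lra. Qed.

Lemma ERle_refl (a : ER) : ERle a a.
Proof. destruct a; simpl; auto; apply Rle_refl. Qed.

Lemma ERpsum_mono (f : nat -> ER) (N M : nat) :
  (forall k, ERle (ERfin 0) (f k)) -> (N <= M)%nat -> ERle (ERpsum f N) (ERpsum f M).
Proof.
  intros Hf HNM; induction HNM as [|M HNM IH]; [apply ERle_refl|].
  apply ERle_trans with (1 := IH), ERle_plus_l, Hf.
Qed.

Definition ERval (a : ER) : R := match a with ERfin r => r | ERinf => 0 end.

Lemma ex_least (P : nat -> Prop) :
  (exists k, P k) -> exists k, P k /\ forall i, (i < k)%nat -> ~ P i.
Proof.
  intros HP.
  destruct (dec_inh_nat_subset_has_unique_least_element P (fun k => classic (P k)) HP)
    as [k [[Hk Hmin] _]].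
  exists k; split; [exact Hk|]; intros i Hi HPi; specialize (Hmin i HPi); lia.
Qed.

Definition indicator (P : Prop) : R := if excluded_middle_informative P then 1 else 0.

Lemma indicator_true (P : Prop) : P -> indicator P = 1.
Proof. intros HP; unfold indicator; destruct excluded_middle_informative; tauto. Qed.

Lemma indicator_false (P : Prop) : ~ P -> indicator P = 0.
Proof. intros HP; unfold indicator; destruct excluded_middle_informative; tauto. Qed.

Lemma indicator_bounds (P : Prop) : 0 <= indicator P <= 1.
Proof. unfold indicator; destruct excluded_middle_informative; lra. Qed.

Section BorelMeasure.

Variables (n : nat) (mu : (Vec n -> Prop) -> ER).
Hypothesis mu_measure : is_borel_measure mu.

Lemma mu_nonneg (A : Vec n -> Prop) : is_borel A -> ERle (ERfin 0) (mu A).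
Proof. apply mu_measure. Qed.

Lemma mu_disjoint_or (A B : Vec n -> Prop) :
  is_borel A -> is_borel B -> (forall x, A x -> B x -> False) ->
  mu (fun x => A x \/ B x) = ERplus (mu A) (mu B).
Proof.
  intros HA HB Hdisj; destruct mu_measure as [Hempty [_ Hadd]].
  set (F := fun k : nat => match k with O => A | S O => B | _ => fun _ => False end).
  assert (HF : forall k, is_borel (F k)) by (intros [|[|k]]; simpl; auto using @borel_empty).
  destruct (Hadd F HF) as [Hub Hleast].
  { intros [|[|i]] [|[|j]] x; simpl; intros; try tauto; try lia; eauto. }
  replace (fun x => A x \/ B x) with (fun x => exists k, F k x).
  2: { apply set_ext; intros x; split.
       - intros [[|[|k]] Hx]; simpl in Hx; tauto.
       - intros [Hx|Hx]; [exists O | exists 1%nat]; exact Hx. }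
  assert (Htwo : ERpsum (fun k => mu (F k)) 2 = ERplus (mu A) (mu B)).
  { simpl; destruct (mu A), (mu B); simpl; try reflexivity; f_equal; ring. }
  assert (Hmore : forall N, ERpsum (fun k => mu (F k)) (2 + N) = ERplus (mu A) (mu B)).
  { induction N as [|N IH]; [exact Htwo|].
    rewrite Nat.add_succ_r; cbn [ERpsum]; rewrite IH; simpl.
    rewrite Hempty; apply ERplus_0_r. }
  apply ERle_antisym.
  - apply Hleast; intros y [N ->].
    rewrite <- (Hmore N); apply ERpsum_mono; [|lia].
    intros k; apply mu_nonneg, HF.
  - rewrite <- Htwo; apply Hub; exists 2%nat; reflexivity.
Qed.

Lemma mu_split (B E : Vec n -> Prop) : is_borel B -> is_borel E ->
  mu B = ERplus (mu (fun x => B x /\ E x)) (mu (fun x => B x /\ ~ E x)).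
Proof.
  intros HB HE; rewrite <- mu_disjoint_or; auto using @borel_and, @borel_diff; [|tauto].
  f_equal; apply set_ext; intros x; tauto.
Qed.

Lemma mu_mono (A B : Vec n -> Prop) :
  is_borel A -> is_borel B -> (forall x, A x -> B x) -> ERle (mu A) (mu B).
Proof.
  intros HA HB HAB; rewrite (mu_split B A HB HA).
  replace (fun x => B x /\ A x) with A by (apply set_ext; firstorder).
  apply ERle_plus_l, mu_nonneg, borel_diff; assumption.
Qed.

Definition null (A : Vec n -> Prop) : Prop := is_borel A /\ mu A = ERfin 0.

Lemma null_empty : null (fun _ => False).
Proof. split; [apply borel_empty | apply mu_measure]. Qed.

Lemma null_subset (A B : Vec n -> Prop) :
  is_borel A -> null B -> (forall x, A x -> B x) -> null A.
Proof.
  intros HA [HB HB0] HAB; split; [exact HA|].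
  apply ERle_antisym; [rewrite <- HB0; apply mu_mono | apply mu_nonneg]; assumption.
Qed.

Lemma null_guard (P : Prop) (A : Vec n -> Prop) : (P -> null A) -> null (fun x => P /\ A x).
Proof.
  intros HA; destruct (set_guard P A) as [[HP ->] | ->]; auto using null_empty.
Qed.

Lemma null_countable_union (F : nat -> Vec n -> Prop) :
  (forall k, null (F k)) -> null (fun x => exists k, F k x).
Proof.
  intros HF; assert (HFb : forall k, is_borel (F k)) by apply HF.
  set (G := fun k x => F k x /\ ~ exists i, (i < k)%nat /\ F i x).
  assert (HG : forall k, null (G k)).
  { intros k; apply null_subset with (F k); [|apply HF | intros x [Hx _]; exact Hx].
    apply borel_diff, borel_ex_lt; auto. }
  replace (fun x => exists k, F k x) with (fun x => exists k, G k x).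
  2: { apply set_ext; intros x; split; [intros [k [Hk _]]; eauto|].
       intros Hx; destruct (ex_least _ Hx) as [k [Hk Hmin]].
       exists k; split; [exact Hk|]; intros [i [Hi HFi]]; exact (Hmin i Hi HFi). }
  assert (Hborel : is_borel (fun x => exists k, G k x)) by (apply borel_union; apply HG).
  split; [exact Hborel|].
  apply ERle_antisym; [|apply mu_nonneg, Hborel].
  apply mu_measure; [apply HG | |].
  - intros i j x Hij [Hi Hi'] [Hj Hj'].
    destruct (lt_eq_lt_dec i j) as [[Hlt|Heq]|Hlt]; [apply Hj' | exact (Hij Heq) | apply Hi'];
      eauto.
  - intros y [N ->]; induction N as [|N IH]; [apply ERle_refl|]; cbn [ERpsum].
    rewrite (proj2 (HG N)), ERplus_0_r; exact IH.
Qed.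

Lemma null_union_over_nat_vectors (m : nat) (F : (Fin.t m -> nat) -> Vec n -> Prop) :
  (forall q, null (F q)) -> null (fun x => exists q, F q x).
Proof.
  induction m as [|m IH]; intros HF.
  - replace (fun x => exists q, F q x) with (F (fun _ => O)); [apply HF|].
    apply set_ext; intros x; split; [eauto | intros [q Hq]].
    replace (fun _ => O) with q; [exact Hq | extensionality i; inversion i].
  - replace (fun x => exists q, F q x)
      with (fun x => exists k, (fun k x => exists q, F (fcons k q) x) k x).
    + apply null_countable_union; intros k; apply (IH (fun q => F (fcons k q))); auto.
    + apply set_ext; intros x; split; [intros [k [q Hq]]; eauto|].
      intros [q Hq]; exists (q Fin.F1), (fun i => q (Fin.FS i)); rewrite fcons_eta; exact Hq.
Qed.

Lemma rational_grid_dense (x : Vec n) (N : nat) : exists a b : Fin.t n -> nat,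
  dist (fun i => (INR (a i) - INR (b i)) / INR (S N)) x <= INR n * / INR (S N).
Proof.
  assert (HN : 0 < INR (S N)) by (apply lt_0_INR; lia).
  exists (fun i => Z.to_nat (Zfloor (x i * INR (S N)))),
    (fun i => Z.to_nat (- Zfloor (x i * INR (S N)))).
  rewrite dist_norm; apply norm_le_coord; [apply Rlt_le, Rinv_0_lt_compat, HN|].
  intros i; unfold vsub; set (z := Zfloor (x i * INR (S N))).
  replace (INR _ - INR _) with (IZR z)
    by (rewrite !INR_IZR_INZ, <- minus_IZR; f_equal; lia).
  pose proof (Zfloor_bound (x i * INR (S N))) as Hz; fold z in Hz.
  replace (IZR z / INR (S N) - x i) with ((IZR z - x i * INR (S N)) / INR (S N))
    by (field; lra).
  rewrite Rabs_div, (Rabs_right (INR (S N))) by lra.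
  apply Rle_div_l; [exact HN|]; rewrite Rinv_l by lra; apply Rabs_le; lra.
Qed.

(* The complement of the support is a countable union of null balls with rational centres. *)
Lemma null_off_supp (B : Vec n -> Prop) :
  is_borel B -> (forall x, B x -> ~ supp mu x) -> null B.
Proof.
  intros HB Hoff.
  set (ball := fun N (a b : Fin.t n -> nat) =>
    cball (fun i => (INR (a i) - INR (b i)) / INR (S N)) (INR n * / INR (S N))).
  apply null_subset with (fun x => exists N, (fun N x => exists a, (fun a x => exists b,
    (fun b x => null (ball N a b) /\ ball N a b x) b x) a x) N x).
  - exact HB.
  - apply null_countable_union; intros N.
    apply null_union_over_nat_vectors; intros a.
    apply null_union_over_nat_vectors; intros b.
    apply null_guard; auto.
  - intros x Hx; destruct (not_all_ex_not _ _ (Hoff x Hx)) as [r Hr].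
    apply imply_to_and in Hr; destruct Hr as [Hr Hzero].
    destruct (INR_archimed r (2 * INR n)) as [N HN]; [lra|].
    destruct (rational_grid_dense x N) as [a [b Hab]].
    exists N, a, b; split; [|exact Hab].
    apply null_subset with (cball x r); [apply borel_cball | split; [apply borel_cball|] |].
    + apply ERle_antisym; [|apply mu_nonneg, borel_cball].
      destruct (mu (cball x r)); simpl in *; [lra | tauto].
    + intros y; apply cball_subset; rewrite dist_sym.
      assert (INR n * / INR (S N) <= r / 2); [|lra].
      rewrite S_INR; pose proof (pos_INR N).
      apply Rle_div_l; [lra|]; nra.
Qed.

Lemma supp_meets (B : Vec n -> Prop) :
  is_borel B -> mu B <> ERfin 0 -> exists x, B x /\ supp mu x.
Proof.
  intros HB Hpos; apply NNPP; intros Hnone.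
  apply Hpos, null_off_supp; [exact HB|]; intros x Hx Hs; apply Hnone; eauto.
Qed.

Definition mass (A : Vec n -> Prop) : R := ERval (mu A).

Lemma mass_split (B E : Vec n -> Prop) :
  is_borel B -> is_borel E -> mu B <> ERinf ->
  mu (fun x => B x /\ E x) <> ERinf /\ mu (fun x => B x /\ ~ E x) <> ERinf /\
  mass B = mass (fun x => B x /\ E x) + mass (fun x => B x /\ ~ E x).
Proof.
  unfold mass; intros HB HE; rewrite (mu_split B E HB HE).
  destruct (mu (fun x => B x /\ E x)), (mu (fun x => B x /\ ~ E x)); simpl;
    intros Hfin; try tauto; repeat split; congruence.
Qed.

(* By induction on the number of pieces: [B] is split along the first one. *)
Lemma simple_function_average {m : nat} (w : Fin.t m -> R) (E : Fin.t m -> Vec n -> Prop)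
  (t : R) (B : Vec n -> Prop) :
  (forall j, is_borel (E j)) -> is_borel B -> mu B <> ERinf ->
  (forall x, B x -> supp mu x -> t <= sumFin m (fun j => w j * indicator (E j x))) ->
  t * mass B <= sumFin m (fun j => w j * mass (fun x => B x /\ E j x)).
Proof.
  revert t B; induction m as [|m IH]; intros t B HE HB Hfin Ht; simpl.
  - destruct (Rle_dec t 0) as [Ht0|Ht0].
    + pose proof (mu_nonneg B HB) as Hpos; unfold mass; destruct (mu B); simpl in *; nra.
    + destruct (null_off_supp B HB) as [_ HB0]; [|unfold mass; rewrite HB0; simpl; lra].
      intros x Hx Hs; specialize (Ht x Hx Hs); simpl in Ht; lra.
  - set (E0 := E Fin.F1); set (E' := fun j => E (Fin.FS j)); set (w' := fun j => w (Fin.FS j)).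
    assert (HE0 : is_borel E0) by apply HE.
    assert (HE' : forall j, is_borel (E' j)) by (intros j; apply HE).
    destruct (mass_split B E0 HB HE0 Hfin) as [Hfin_in [Hfin_out ->]].
    assert (Hin : (t - w Fin.F1) * mass (fun x => B x /\ E0 x)
                  <= sumFin m (fun j => w' j * mass (fun x => (B x /\ E0 x) /\ E' j x))).
    { apply IH; auto using @borel_and; intros x [Hx HEx] Hs.
      specialize (Ht x Hx Hs); simpl in Ht; fold E0 in Ht; rewrite (indicator_true _ HEx) in Ht.
      unfold w', E'; lra. }
    assert (Hout : t * mass (fun x => B x /\ ~ E0 x)
                   <= sumFin m (fun j => w' j * mass (fun x => (B x /\ ~ E0 x) /\ E' j x))).
    { apply IH; auto using @borel_diff; intros x [Hx HEx] Hs.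
      specialize (Ht x Hx Hs); simpl in Ht; fold E0 in Ht; rewrite (indicator_false _ HEx) in Ht.
      unfold w', E'; lra. }
    replace (sumFin m _) with
      (sumFin m (fun j => w' j * mass (fun x => (B x /\ E0 x) /\ E' j x)) +
       sumFin m (fun j => w' j * mass (fun x => (B x /\ ~ E0 x) /\ E' j x))); [lra|].
    rewrite <- sumFin_plus; apply sumFin_ext; intros j; fold (E' j) (w' j).
    destruct (mass_split B (E' j) HB (HE' j) Hfin) as [Hfin_j _].
    destruct (mass_split _ E0 (borel_and _ _ HB (HE' j)) HE0 Hfin_j) as [_ [_ ->]].
    rewrite <- Rmult_plus_distr_l; do 2 f_equal; f_equal; apply set_ext; intros x; tauto.
Qed.

(* Balls of the game may have infinite measure, since local finiteness is not uniform. *)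
Lemma infinite_measure_avoids {m : nat} (E : Fin.t m -> Vec n -> Prop) (B : Vec n -> Prop) :
  (forall j, is_borel (E j)) -> is_borel B -> mu B = ERinf ->
  (forall j, mu (fun x => B x /\ E j x) <> ERinf) ->
  exists x, B x /\ supp mu x /\ forall j, ~ E j x.
Proof.
  revert B; induction m as [|m IH]; intros B HE HB Hinf Hfin.
  - destruct (supp_meets B HB) as [x [Hx Hs]]; [rewrite Hinf; discriminate|].
    exists x; repeat split; auto; intros j; inversion j.
  - destruct (IH (fun j => E (Fin.FS j)) (fun x => B x /\ ~ E Fin.F1 x))
      as [x [[Hx Hx0] [Hs Hx']]]; auto using @borel_diff.
    + rewrite (mu_split B (E Fin.F1)) in Hinf by auto; specialize (Hfin Fin.F1).
      destruct (mu (fun x => B x /\ E Fin.F1 x)), (mu (fun x => B x /\ ~ E Fin.F1 x));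
        simpl in *; congruence.
    + intros j Hj; apply (Hfin (Fin.FS j)).
      pose proof (mu_mono (fun x => (B x /\ ~ E Fin.F1 x) /\ E (Fin.FS j) x)
                          (fun x => B x /\ E (Fin.FS j) x)) as Hle.
      rewrite Hj in Hle.
      destruct (mu (fun x => B x /\ E (Fin.FS j) x)); [|reflexivity].
      exfalso; apply Hle; auto using @borel_and, @borel_diff; tauto.
    + exists x; repeat split; auto.
      intros j; apply (Fin.caseS' j); [exact Hx0 | exact Hx'].
Qed.

Lemma finite_measure_weighted_avoidance {m : nat} (w : Fin.t m -> R)
  (E : Fin.t m -> Vec n -> Prop) (c : R) (B : Vec n -> Prop) :
  (forall j, 0 <= w j) -> (forall j, is_borel (E j)) -> is_borel B ->
  0 < mass B -> (forall j, mass (fun x => B x /\ E j x) < c * mass B) ->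
  exists x, B x /\ supp mu x /\ sumFin m (fun j => w j * indicator (E j x)) <= c * sumFin m w.
Proof.
  intros Hw HE HB Hpos Hsmall.
  set (gap := fun j => c * mass B - mass (fun x => B x /\ E j x)).
  assert (Hgap : forall j, 0 < gap j) by (intros j; specialize (Hsmall j); unfold gap; lra).
  assert (HBfin : mu B <> ERinf /\ mu B <> ERfin 0)
    by (unfold mass in Hpos; split; intros HB0; rewrite HB0 in Hpos; simpl in Hpos; lra).
  apply NNPP; intros Hnone.
  assert (Habove : forall x, B x -> supp mu x ->
            c * sumFin m w < sumFin m (fun j => w j * indicator (E j x)))
    by (intros x Hx Hs; apply Rnot_le_lt; intros Hle; apply Hnone; eauto).
  assert (Hgap_sum : sumFin m (fun j => w j * gap j) <= 0).
  { assert (Havg : c * sumFin m w * mass B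
                   <= sumFin m (fun j => w j * mass (fun x => B x /\ E j x))).
    { apply simple_function_average; auto; [tauto|].
      intros x Hx Hs; apply Rlt_le, Habove; assumption. }
    replace (sumFin m _) with
      (c * mass B * sumFin m w - sumFin m (fun j => w j * mass (fun x => B x /\ E j x))); [lra|].
    rewrite <- sumFin_scal, <- sumFin_minus; apply sumFin_ext; intros j; unfold gap; ring. }
  assert (Hw0 : forall j, w j = 0).
  { intros j; specialize (Hw j) as Hwj; specialize (Hgap j) as Hgapj.
    assert (Hterm : w j * gap j <= sumFin m (fun j => w j * gap j)).
    { apply (sumFin_ge_term (fun j => w j * gap j)).
      intros i; apply Rmult_le_pos; [apply Hw | apply Rlt_le, Hgap]. }
    nra. }
  destruct (supp_meets B HB (proj2 HBfin)) as [x [Hx Hs]].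
  specialize (Habove x Hx Hs); rewrite (sumFin_zero w Hw0), sumFin_zero in Habove; [lra|].
  intros j; rewrite Hw0; ring.
Qed.

Lemma weighted_avoidance {m : nat} (w : Fin.t m -> R) (E : Fin.t m -> Vec n -> Prop) (c : R)
  (B : Vec n -> Prop) :
  0 <= c -> (forall j, 0 <= w j) -> (forall j, is_borel (E j)) -> is_borel B ->
  ERlt (ERfin 0) (mu B) ->
  (forall j, ERlt (mu (fun x => B x /\ E j x)) (ERscale c (mu B))) ->
  exists x, B x /\ supp mu x /\ sumFin m (fun j => w j * indicator (E j x)) <= c * sumFin m w.
Proof.
  intros Hc Hw HE HB Hpos Hsmall.
  destruct (mu B) as [b|] eqn:HmuB.
  - apply finite_measure_weighted_avoidance; auto; unfold mass; rewrite HmuB; [exact Hpos|].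
    intros j; specialize (Hsmall j).
    destruct (mu (fun x => B x /\ E j x)); simpl in *; [exact Hsmall | tauto].
  - destruct (infinite_measure_avoids E B HE HB HmuB) as [x [Hx [Hs Havoid]]].
    + intros j Hj; specialize (Hsmall j); rewrite Hj in Hsmall; exact Hsmall.
    + exists x; repeat split; auto.
      rewrite (sumFin_zero (fun j => w j * indicator (E j x))).
      * apply Rmult_le_pos; [exact Hc | apply sumFin_nonneg, Hw].
      * intros j; rewrite indicator_false by apply Havoid; ring.
Qed.

End BorelMeasure.

Definition thin_slabs {n : nat} (mu : (Vec n -> Prop) -> ER) (c a rho0 : R) : Prop :=
  forall (v : Vec n) (b : R) (x : Vec n) (rho : R),
    0 < norm v -> supp mu x -> 0 < rho < rho0 ->
    ERlt (mu (fun y => cball x rho y /\ slab v b (a * rho * norm v) y))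
         (ERscale c (mu (cball x rho))).

Lemma ex_mul_Rpower_le (C gam c : R) : 0 < C -> 0 < gam -> 0 < c ->
  exists a, 0 < a <= 1 /\ C * Rpower a gam <= c.
Proof.
  intros HC Hgam Hc; set (a := Rpower (c / C) (/ gam)).
  assert (Ha : 0 < a) by apply exp_pos.
  exists (Rmin 1 a); repeat split; [apply Rmin_pos; lra | apply Rmin_l |].
  apply Rle_trans with (C * Rpower a gam).
  - apply Rmult_le_compat_l; [lra|]; apply Rle_Rpower_l; [lra|].
    split; [apply Rmin_pos; lra | apply Rmin_r].
  - assert (0 < c / C) by (apply Rdiv_lt_0_compat; lra).
    unfold a; rewrite Rpower_mult, Rinv_l, Rpower_1 by lra.
    apply Req_le; field; lra.
Qed.

Lemma abs_decaying_thin_slabs {n : nat} (mu : (Vec n -> Prop) -> ER) (c : R) :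
  is_borel_measure mu -> abs_decaying mu -> 0 < c ->
  exists a rho0, 0 < a <= 1 /\ 0 < rho0 /\ thin_slabs mu c a rho0.
Proof.
  intros Hmu [C [gam [HC [Hgam [rho0 [Hrho0 Hdecay]]]]]] Hc.
  destruct (ex_mul_Rpower_le C gam c HC Hgam Hc) as [a [Ha HCa]].
  exists a, rho0; repeat split; try lra.
  intros v b x rho Hv Hx Hrho.
  assert (Hdec := Hdecay v b (norm_pos_nonzero v Hv) x Hx rho (proj1 Hrho) (proj2 Hrho)
                    (a * rho) ltac:(nra)).
  rewrite nbhd_hyperplane in Hdec by exact Hv.
  replace (a * rho / rho) with a in Hdec by (field; lra).
  pose proof (mu_nonneg n mu Hmu _ (borel_cball x rho)) as Hpos.
  destruct (mu (cball x rho)) as [m|]; [|exact Hdec].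
  destruct (mu (fun y => cball x rho y /\ _)); simpl in *; [nra | exact Hdec].
Qed.

(** * Positional strategies *)

(* Only Bob's balls are recorded: Alice answers [w] with the ball of centre [pick w] and radius
   [alpha * snd w]. *)
Definition play {n : nat} (K : Vec n -> Prop) (alpha beta : R) (pick : Ball n -> Vec n)
  (b : nat -> Ball n) : Prop :=
  forall k, K (fst (b k)) /\ 0 < snd (b k) /\ snd (b (S k)) = alpha * beta * snd (b k) /\
    snd (b (S k)) + dist (pick (b k)) (fst (b (S k))) <= alpha * snd (b k).

Lemma play_tail {n : nat} (K : Vec n -> Prop) (alpha beta : R) (pick : Ball n -> Vec n)
  (b : nat -> Ball n) (t : nat) :
  play K alpha beta pick b -> play K alpha beta pick (fun k => b (t + k)%nat).
Proof. intros Hb k; rewrite Nat.add_succ_r; apply Hb. Qed.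

Lemma play_radius {n : nat} (K : Vec n -> Prop) (alpha beta : R) (pick : Ball n -> Vec n)
  (b : nat -> Ball n) (k : nat) :
  play K alpha beta pick b -> snd (b k) = snd (b O) * (alpha * beta) ^ k.
Proof.
  intros Hb; induction k as [|k IH]; simpl; [ring|].
  destruct (Hb k) as [_ [_ [-> _]]]; rewrite IH; ring.
Qed.

Lemma geometric_scale (r eta t : R) : 0 < r < 1 -> 0 < eta -> 0 < t ->
  exists k, Rmin (eta * r) t <= t * r ^ k <= eta.
Proof.
  intros Hr Heta Ht.
  destruct (ex_least (fun k => t * r ^ k <= eta)) as [k [Hk Hmin]].
  - destruct (pow_lt_1_zero r) with (y := eta / t) as [k Hk].
    + rewrite Rabs_right; lra.
    + apply Rdiv_lt_0_compat; assumption.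
    + exists k; specialize (Hk k (Nat.le_refl k)).
      rewrite Rabs_right in Hk by (apply Rle_ge, pow_le; lra).
      apply Rlt_div_r in Hk; lra.
  - exists k; split; [|exact Hk]; destruct k as [|k].
    + simpl; rewrite Rmult_1_r; apply Rmin_r.
    + apply Rle_trans with (1 := Rmin_l _ _).
      assert (Hprev : eta < t * r ^ k) by (apply Rnot_le_lt, Hmin; lia).
      simpl; nra.
Qed.

Lemma play_small_radius {n : nat} (K : Vec n -> Prop) (alpha beta : R)
  (pick : Ball n -> Vec n) (b : nat -> Ball n) (eps : R) :
  0 < alpha * beta < 1 -> 0 < eps -> play K alpha beta pick b -> exists t, snd (b t) <= eps.
Proof.
  intros Hab Heps Hb; destruct (Hb O) as [_ [Hpos _]].
  destruct (geometric_scale (alpha * beta) eps (snd (b O)) Hab Heps Hpos) as [t [_ Ht]].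
  exists t; rewrite (play_radius _ _ _ _ _ t Hb); exact Ht.
Qed.

Lemma last_bob_prefix {n : nat} (b : nat -> Ball n) (k : nat) (d : Ball n) :
  last (bob_prefix b k) d = b k.
Proof. unfold bob_prefix; rewrite seq_S, map_app; apply last_last. Qed.

Lemma positional_strategy_wins {n : nat} (K T : Vec n -> Prop) (alpha beta : R)
  (pick : Ball n -> Vec n) :
  0 < alpha -> 0 < beta ->
  (forall w, K (fst w) -> 0 < snd w ->
    K (pick w) /\ dist (fst w) (pick w) <= (1 - alpha) * snd w) ->
  (forall b, play K alpha beta pick b -> forall y, (forall k, in_ball K (b k) y) -> T y) ->
  ab_winning K T alpha beta.
Proof.
  intros Ha Hb Hpick Hwin.
  set (s := fun l : list (Ball n) =>
    let w := last l (fun _ => 0, 0) in (pick w, alpha * snd w)).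
  assert (Hmove : forall b k, alice_move s b k = (pick (b k), alpha * snd (b k)))
    by (intros b k; unfold alice_move, s; rewrite last_bob_prefix; reflexivity).
  assert (Hlegal : forall b k, (forall j, (j <= k)%nat -> bob_legal K beta s b j) ->
            K (fst (b k)) /\ 0 < snd (b k)).
  { intros b k; induction k as [|k IH]; intros Hl; [exact (Hl O (Nat.le_refl 0))|].
    destruct IH as [_ Hpos]; [intros j Hj; apply Hl; lia|].
    destruct (Hl (S k) (Nat.le_refl _)) as [HK [Hrad _]].
    rewrite Hmove in Hrad; split; [exact HK|].
    rewrite Hrad; repeat apply Rmult_lt_0_compat; simpl; assumption. }
  exists s; intros b; split.
  - intros k Hl; destruct (Hlegal b k Hl) as [HK Hpos].
    destruct (Hpick (b k) HK Hpos) as [HK' Hdist].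
    unfold alice_legal, ball_le; rewrite Hmove; simpl; repeat split; [exact HK' | lra].
  - intros Hl y Hy; split; [|apply (Hy O)]; apply (Hwin b); [|exact Hy].
    intros k; destruct (Hlegal b k (fun j _ => Hl j)) as [HK Hpos].
    destruct (Hl (S k)) as [_ [Hrad Hle]]; rewrite Hmove in Hrad, Hle.
    unfold ball_le in Hle; simpl in Hrad, Hle; repeat split; auto; rewrite Hrad; ring.
Qed.

(** * Avoiding a dyadic sequence of families of parallel hyperplanes *)

Definition fin_index {J : nat} (j : Fin.t J) : nat := proj1_sig (Fin.to_nat j).

Definition partial_sum (f : nat -> R) (J : nat) : R :=
  sumFin J (fun j => f (fin_index j)).

Lemma partial_sum_S (f : nat -> R) (J : nat) :
  partial_sum f (S J) = f O + partial_sum (fun j => f (S j)) J.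
Proof.
  unfold partial_sum; simpl; f_equal; apply sumFin_ext; intros j.
  unfold fin_index; simpl; destruct (Fin.to_nat j); reflexivity.
Qed.

Lemma partial_sum_ge_term (f : nat -> R) (J j : nat) :
  (forall i, 0 <= f i) -> (j < J)%nat -> f j <= partial_sum f J.
Proof.
  intros Hf Hj.
  pose proof (sumFin_ge_term (fun i => f (fin_index i)) (Fin.of_nat_lt Hj)) as Hle.
  unfold fin_index in Hle; rewrite Fin.to_nat_of_nat in Hle; apply Hle; auto.
Qed.

Lemma partial_sum_le_support (f : nat -> R) (J J0 : nat) :
  (forall j, 0 <= f j) -> (forall j, (J0 <= j)%nat -> f j = 0) ->
  partial_sum f J <= partial_sum f J0.
Proof.
  revert f J0; induction J as [|J IH]; intros f J0 Hf Hsupp.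
  - apply sumFin_nonneg; auto.
  - rewrite partial_sum_S; destruct J0 as [|J0].
    + rewrite (Hsupp O) by lia; rewrite Rplus_0_l.
      apply (IH (fun j => f (S j)) O); intros j; [apply Hf | intros _; apply Hsupp; lia].
    + rewrite partial_sum_S; apply Rplus_le_compat_l, IH; intros j; [apply Hf|].
      intros Hj; apply Hsupp; lia.
Qed.

Lemma Rpower_neg_anti (a b s : R) : 0 < a <= b -> 0 < s -> Rpower b (- s) <= Rpower a (- s).
Proof.
  intros Hab Hs; rewrite !Rpower_Ropp.
  apply Rinv_le_contravar; [apply exp_pos | apply Rle_Rpower_l; lra].
Qed.

Lemma Rpower_2_neg_lt_1 (s : R) : 0 < s -> Rpower 2 (- s) < 1.
Proof. intros Hs; rewrite <- (Rpower_O 2) by lra; apply Rpower_lt; lra. Qed.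

Lemma ex_Rpower_neg_eq_2 (r : R) : 0 < r < 1 -> exists s, 0 < s /\ Rpower r (- s) = 2.
Proof.
  intros Hr.
  assert (Hln : ln r < 0) by (rewrite <- ln_1; apply ln_increasing; lra).
  assert (Hln2 : 0 < ln 2) by (rewrite <- ln_1; apply ln_increasing; lra).
  exists (ln 2 / - ln r); split; [apply Rdiv_lt_0_compat; lra|].
  replace (- (ln 2 / - ln r)) with (Rlog r 2) by (unfold Rlog; field; lra).
  apply Rpower_Rlog; lra.
Qed.

Definition weight (s : R) (j : nat) (rho : R) : R := Rpower (2 ^ j * rho) (- s).

Lemma weight_pos (s : R) (j : nat) (rho : R) : 0 < weight s j rho.
Proof. apply exp_pos. Qed.

Lemma weight_indicator_nonneg (s : R) (j : nat) (rho : R) (P : Prop) :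
  0 <= weight s j rho * indicator P.
Proof. apply Rmult_le_pos; [apply Rlt_le, weight_pos | apply indicator_bounds]. Qed.

Lemma weight_mul (s c : R) (j : nat) (rho : R) : 0 < c -> 0 < rho ->
  weight s j (c * rho) = Rpower c (- s) * weight s j rho.
Proof.
  intros Hc Hrho; assert (0 < 2 ^ j) by (apply pow_lt; lra).
  unfold weight; rewrite Rpower_mult_distr by nra; f_equal; ring.
Qed.

(* By induction on [J]: passing from [j] to [j + 1] amounts to doubling [rho]. *)
Lemma weight_tail_sum (s c rho : R) (J : nat) : 0 < s -> 0 < rho ->
  partial_sum (fun j => weight s j rho * indicator (c < 2 ^ j * rho)) J
  <= Rpower (Rmax rho c) (- s) / (1 - Rpower 2 (- s)).
Proof.
  intros Hs; revert rho.
  pose proof (Rpower_2_neg_lt_1 s Hs) as Hratio.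
  induction J as [|J IH]; intros rho Hrho.
  - apply Rdiv_le_0_compat; [apply Rlt_le, exp_pos | lra].
  - rewrite partial_sum_S.
    replace (partial_sum _ J)
      with (partial_sum (fun j => weight s j (2 * rho) * indicator (c < 2 ^ j * (2 * rho))) J).
    2: { apply sumFin_ext; intros i; set (j := fin_index i); unfold weight.
         replace (2 ^ j * (2 * rho)) with (2 ^ S j * rho) by (simpl; ring); reflexivity. }
    specialize (IH (2 * rho) ltac:(lra)); simpl; rewrite Rmult_1_l.
    destruct (Rlt_le_dec c rho) as [Hc|Hc].
    + rewrite Rmax_left in * by lra.
      rewrite indicator_true by exact Hc.
      rewrite <- Rpower_mult_distr in IH by lra.
      replace (weight s 0 rho) with (Rpower rho (- s)) by (unfold weight; f_equal; simpl; ring).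
      replace (Rpower rho (- s) / (1 - Rpower 2 (- s))) with
        (Rpower rho (- s) * 1 + Rpower 2 (- s) * Rpower rho (- s) / (1 - Rpower 2 (- s)))
        by (field; lra).
      lra.
    + rewrite indicator_false by lra; rewrite Rmult_0_r, Rplus_0_l.
      apply Rle_trans with (1 := IH), Rmult_le_compat_r.
      * apply Rlt_le, Rinv_0_lt_compat; lra.
      * apply Rpower_neg_anti; [|exact Hs].
        rewrite (Rmax_right rho c) by lra; split; [lra | apply Rmax_r].
Qed.

Definition near_hyperplanes {n : nat} (a : Vec n) (eps : R) (x : Vec n) : Prop :=
  exists p : Z, slab a (IZR p) (eps * norm a) x.

Lemma near_hyperplanes_shift {n : nat} (a : Vec n) (eps eps' : R) (x y : Vec n) :
  near_hyperplanes a eps x -> eps + dist x y <= eps' -> near_hyperplanes a eps' y.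
Proof.
  intros [p Hp] Heps; exists p.
  apply (slab_shift _ _ _ (dist x y) x y) in Hp; [|apply Rle_refl].
  pose proof (norm_nonneg a); unfold slab in *; nra.
Qed.

(* The hyperplane [a . y = p] nearest to [x] is the only one that can meet a ball around [x] much
   smaller than the gaps. *)
Definition nearest_slab {n : nat} (a : Vec n) (x : Vec n) (c : R) : Vec n -> Prop :=
  slab a (IZR (Zfloor (dot a x + 1 / 2))) c.

Lemma near_hyperplanes_nearest_slab {n : nat} (a x x' : Vec n) (eps rho : R) :
  norm a * rho <= 1 / 4 -> dist x x' <= rho -> eps <= rho / 2 ->
  near_hyperplanes a eps x' -> nearest_slab a x (eps * norm a) x'.
Proof.
  intros Hrho Hdist Heps [p Hp]; unfold nearest_slab.
  replace (Zfloor _) with p; [exact Hp|].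
  apply (slab_shift _ _ _ rho x' x) in Hp; [|rewrite dist_sym; exact Hdist].
  unfold slab in Hp; apply Rabs_le_between in Hp.
  pose proof (norm_nonneg a); symmetry; apply Zfloor_eq; nra.
Qed.

Definition avoids_hyperplanes {n : nat} (z : nat -> Vec n) (y : Vec n) : Prop :=
  exists delta, 0 < delta /\ forall j (p : Z), delta <= Rabs (dot (z j) y - IZR p).

Section HyperplaneGame.

Variables (n : nat) (z : nat -> Vec n) (s : R).
Hypothesis s_pos : 0 < s.
Hypothesis z_lower : forall j, 2 ^ j <= 2 * norm (z j).

Definition potential (J : nat) (x : Vec n) (rho : R) : R :=
  partial_sum (fun j => weight s j rho * indicator (near_hyperplanes (z j) (2 * rho) x)) J.

Lemma potential_bounded (x : Vec n) (rho : R) :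
  0 < rho -> exists D, forall J, potential J x rho <= D.
Proof.
  intros Hrho; eexists; intros J.
  apply Rle_trans with (2 := weight_tail_sum s 0 rho J s_pos Hrho).
  apply sumFin_le; intros j; apply Rmult_le_compat_l; [apply Rlt_le, weight_pos|].
  rewrite (indicator_true (0 < _)); [apply indicator_bounds|].
  apply Rmult_lt_0_compat; [apply pow_lt; lra | exact Hrho].
Qed.

(* When [2^j rho] is small enough, the weight of [j] exceeds the bound [D] on the potential, so
   that the ball is far from all the hyperplanes [z_j . y = p]. *)
Lemma potential_bound_avoids (r D : R) (x : nat -> Vec n) (rho : nat -> R) (y : Vec n) :
  0 < r < 1 -> 0 < rho O -> (forall k, rho k = rho O * r ^ k) ->
  (forall k J, potential J (x k) (rho k) <= D) -> (forall k, dist (x k) y <= rho k) ->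
  avoids_hyperplanes z y.
Proof.
  intros Hr Hrho0 Hrho Hpot Hy.
  assert (HD : 0 <= D) by exact (Hpot O O).
  set (eta := Rpower (D + 1) (- / s)).
  assert (Heta : 0 < eta) by apply exp_pos.
  assert (Heta_weight : Rpower eta (- s) = D + 1).
  { unfold eta; rewrite Rpower_mult.
    replace (- / s * - s) with 1 by (field; lra); apply Rpower_1; lra. }
  exists (Rmin (eta * r) (rho O) / 2); split.
  { assert (0 < Rmin (eta * r) (rho O)) by (apply Rmin_pos; nra); lra. }
  intros j p; assert (H2j : 1 <= 2 ^ j) by (apply pow_R1_Rle; lra).
  destruct (geometric_scale r eta (2 ^ j * rho O) Hr Heta) as [k Hk]; [nra|].
  rewrite Rmult_assoc, <- Hrho in Hk.
  assert (Hrhok : 0 < rho k) by (rewrite Hrho; apply Rmult_lt_0_compat; [|apply pow_lt]; lra).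
  assert (Hfar : ~ near_hyperplanes (z j) (2 * rho k) (x k)).
  { intros Hnear.
    assert (Hterm : weight s j (rho k) * indicator (near_hyperplanes (z j) (2 * rho k) (x k)) <= D).
    { apply Rle_trans with (2 := Hpot k (S j)).
      apply (partial_sum_ge_term (fun j => weight s j (rho k) *
        indicator (near_hyperplanes (z j) (2 * rho k) (x k)))); [|lia].
      intros i; apply weight_indicator_nonneg. }
    rewrite (indicator_true _ Hnear) in Hterm.
    assert (Rpower eta (- s) <= weight s j (rho k)) by (apply Rpower_neg_anti; nra).
    lra. }
  assert (Hmin : Rmin (eta * r) (rho O) <= 2 ^ j * rho k).
  { apply Rle_trans with (2 := proj1 Hk); apply Rle_min_compat_l; nra. }
  specialize (z_lower j).
  apply Rle_trans with (rho k * norm (z j)); [nra|].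
  apply Rnot_lt_le; intros Hclose; apply Hfar.
  apply near_hyperplanes_shift with (rho k) y; [exists p; apply Rlt_le, Hclose|].
  rewrite dist_sym; specialize (Hy k); lra.
Qed.

Variable kappa : R.
Hypothesis kappa_pos : 0 < kappa.
Hypothesis z_upper : forall j, norm (z j) <= kappa * 2 ^ j.

(* The gap [1 / norm (z j)] between consecutive hyperplanes is then at least [4 * rho]. *)
Definition sparse (j : nat) (rho : R) : Prop := 2 ^ j * rho <= / (4 * kappa).

Lemma sparse_norm (j : nat) (rho : R) : 0 < rho -> sparse j rho -> norm (z j) * rho <= 1 / 4.
Proof.
  unfold sparse; intros Hrho Hj.
  apply Rle_trans with (kappa * (2 ^ j * rho)); [rewrite <- Rmult_assoc|].
  - apply Rmult_le_compat_r; [lra | apply z_upper].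
  - apply Rle_trans with (kappa * / (4 * kappa)); [apply Rmult_le_compat_l; lra|].
    apply Req_le; field; lra.
Qed.

Lemma finitely_many_sparse (rho : R) : 0 < rho ->
  exists J, forall j, (J <= j)%nat -> ~ sparse j rho.
Proof.
  intros Hrho.
  destruct (Pow_x_infinity 2) with (b := / (4 * kappa) / rho + 1) as [J HJ].
  - rewrite Rabs_right; lra.
  - exists J; intros j Hj Hsparse; specialize (HJ j Hj).
    rewrite Rabs_right in HJ by (apply Rle_ge, pow_le; lra).
    apply Rle_div_r in Hsparse; lra.
Qed.

Variable alpha : R.
Hypothesis alpha_range : 0 < alpha <= 1 / 4.

(* The potential is compared through its upper bounds [D], so that no number of families to sum
   over has to be fixed. *)
Definition good_move (x : Vec n) (rho : R) (x' : Vec n) : Prop :=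
  forall D, (forall J, potential J x rho <= D) ->
  forall J, partial_sum (fun j => weight s j rho *
    indicator (sparse j rho /\ near_hyperplanes (z j) (2 * alpha * rho) x')) J <= 1 / 4 * D.

Lemma indicator_sparse_near_le (j : nat) (x x' : Vec n) (rho : R) :
  0 < rho -> dist x x' <= rho / 2 ->
  indicator (sparse j rho /\ near_hyperplanes (z j) (2 * alpha * rho) x')
  <= indicator (near_hyperplanes (z j) (2 * rho) x)
     * indicator (nearest_slab (z j) x (2 * alpha * rho * norm (z j)) x').
Proof.
  intros Hrho Hdist.
  destruct (classic (sparse j rho /\ near_hyperplanes (z j) (2 * alpha * rho) x'))
    as [[Hsparse Hnear]|Hno].
  - rewrite !indicator_true; [lra | | | tauto].
    + apply near_hyperplanes_nearest_slab with rho; auto; [|lra | nra].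
      apply sparse_norm; assumption.
    + apply near_hyperplanes_shift with (1 := Hnear); rewrite dist_sym; nra.
  - rewrite (indicator_false _ Hno); apply Rmult_le_pos; apply indicator_bounds.
Qed.

Variables (mu : (Vec n -> Prop) -> ER) (rho0 : R).
Hypothesis mu_measure : is_borel_measure mu.
Hypothesis rho0_pos : 0 < rho0.
Hypothesis mu_thin_slabs : thin_slabs mu (1 / 4) (4 * alpha) rho0.

Lemma good_move_exists (x : Vec n) (rho : R) : supp mu x -> 0 < rho < rho0 ->
  exists x', supp mu x' /\ dist x x' <= rho / 2 /\ good_move x rho x'.
Proof.
  intros Hx Hrho.
  destruct (finitely_many_sparse rho (proj1 Hrho)) as [J0 HJ0].
  set (w := fun j => weight s j rho * indicator (near_hyperplanes (z j) (2 * rho) x)).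
  set (E := fun j => nearest_slab (z j) x (2 * alpha * rho * norm (z j))).
  destruct (weighted_avoidance n mu mu_measure (fun i : Fin.t J0 => w (fin_index i))
    (fun i => E (fin_index i)) (1 / 4) (cball x (rho / 2)))
    as [x' [Hdist [Hx' Havoid]]].
  - lra.
  - intros j; apply weight_indicator_nonneg.
  - intros j; apply borel_slab.
  - apply borel_cball.
  - apply Hx; lra.
  - intros i; set (j := fin_index i); unfold E.
    replace (2 * alpha * rho) with (4 * alpha * (rho / 2)) by field.
    apply mu_thin_slabs; [|exact Hx | lra].
    specialize (z_lower j); assert (0 < 2 ^ j) by (apply pow_lt; lra); lra.
  - exists x'; repeat split; [exact Hx' | exact Hdist |].
    intros D HD J.
    set (f := fun j => weight s j rho *
      indicator (sparse j rho /\ near_hyperplanes (z j) (2 * alpha * rho) x')).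
    assert (Hf : forall j, 0 <= f j) by (intros j; apply weight_indicator_nonneg).
    assert (Hf0 : forall j, (J0 <= j)%nat -> f j = 0).
    { intros j Hj; unfold f; rewrite indicator_false; [ring|].
      intros [Hsparse _]; exact (HJ0 j Hj Hsparse). }
    apply Rle_trans with (1 := partial_sum_le_support f J J0 Hf Hf0).
    apply Rle_trans with (2 := Rmult_le_compat_l (1 / 4) _ _ ltac:(lra) (HD J0)).
    apply Rle_trans with (2 := Havoid), sumFin_le; intros i.
    unfold f, w, E; cbv beta; rewrite (Rmult_assoc (weight _ _ _)); apply Rmult_le_compat_l.
    + apply Rlt_le, weight_pos.
    + apply indicator_sparse_near_le; [lra | exact Hdist].
Qed.

Definition tail_bound : R := Rpower (/ (4 * kappa)) (- s) / (1 - Rpower 2 (- s)).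

Lemma weight_not_sparse_sum (rho : R) (J : nat) : 0 < rho ->
  partial_sum (fun j => weight s j rho * indicator (~ sparse j rho)) J <= tail_bound.
Proof.
  intros Hrho; pose proof (Rpower_2_neg_lt_1 s s_pos) as Hratio.
  apply Rle_trans with (Rpower (Rmax rho (/ (4 * kappa))) (- s) / (1 - Rpower 2 (- s))).
  - apply Rle_trans with (2 := weight_tail_sum s _ rho J s_pos Hrho).
    apply sumFin_le; intros j; apply Rmult_le_compat_l; [apply Rlt_le, weight_pos|].
    destruct (classic (sparse (fin_index j) rho)) as [Hsparse|Hdense].
    + rewrite indicator_false by tauto; apply indicator_bounds.
    + rewrite !indicator_true; [lra | apply Rnot_le_lt, Hdense | exact Hdense].
  - apply Rmult_le_compat_r; [apply Rlt_le, Rinv_0_lt_compat; lra|].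
    apply Rpower_neg_anti; [|exact s_pos].
    split; [apply Rinv_0_lt_compat; lra | apply Rmax_r].
Qed.

Variable beta : R.
Hypothesis beta_range : 0 < beta < 1.
Hypothesis weights_double : Rpower (alpha * beta) (- s) = 2.

Lemma potential_step (D : R) (x x' x'' : Vec n) (rho : R) :
  0 < rho -> 4 * tail_bound <= D ->
  good_move x rho x' -> alpha * beta * rho + dist x' x'' <= alpha * rho ->
  (forall J, potential J x rho <= D) ->
  forall J, potential J x'' (alpha * beta * rho) <= D.
Proof.
  intros Hrho HD Hgood Hdist Hpot J.
  assert (Hab : 0 < alpha * beta) by (apply Rmult_lt_0_compat; lra).
  specialize (Hgood D Hpot J).
  pose proof (weight_not_sparse_sum rho J Hrho) as Htail.
  enough (potential J x'' (alpha * beta * rho)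
          <= 2 * partial_sum (fun j => weight s j rho *
                   indicator (sparse j rho /\ near_hyperplanes (z j) (2 * alpha * rho) x')) J
           + 2 * partial_sum (fun j => weight s j rho * indicator (~ sparse j rho)) J)
    by lra.
  unfold partial_sum; rewrite <- !sumFin_scal, <- sumFin_plus.
  apply sumFin_le; intros i; set (j := fin_index i).
  rewrite weight_mul, weights_double by assumption.
  pose proof (weight_pos s j rho) as Hw.
  pose proof (indicator_bounds (near_hyperplanes (z j) (2 * (alpha * beta * rho)) x'')).
  pose proof (indicator_bounds (sparse j rho /\ near_hyperplanes (z j) (2 * alpha * rho) x')).
  destruct (classic (sparse j rho)) as [Hsparse|Hdense].
  - rewrite (indicator_false (~ _)) by tauto.
    destruct (classic (near_hyperplanes (z j) (2 * (alpha * beta * rho)) x'')) as [Hj|Hj].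
    + rewrite (indicator_true (sparse j rho /\ _)); [nra | split; [exact Hsparse|]].
      apply near_hyperplanes_shift with (1 := Hj).
      rewrite dist_sym; pose proof (dist_nonneg x' x''); lra.
    + rewrite (indicator_false _ Hj); nra.
  - rewrite (indicator_true _ Hdense); nra.
Qed.

Lemma play_potential_bounded (K : Vec n -> Prop) (pick : Ball n -> Vec n) (b : nat -> Ball n) :
  play K alpha beta pick b ->
  (forall k, good_move (fst (b k)) (snd (b k)) (pick (b k))) ->
  exists D, forall k J, potential J (fst (b k)) (snd (b k)) <= D.
Proof.
  intros Hplay Hgood.
  destruct (potential_bounded (fst (b O)) (snd (b O))) as [D0 HD0]; [apply (Hplay O)|].
  exists (Rmax D0 (4 * tail_bound)); induction k as [|k IH].
  - intros J; apply Rle_trans with (1 := HD0 J), Rmax_l.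
  - destruct (Hplay k) as [_ [Hpos [Hrad Hdist]]]; rewrite Hrad in Hdist |- *.
    apply potential_step with (x := fst (b k)) (x' := pick (b k)); auto; apply Rmax_r.
Qed.

Lemma good_strategy_exists : exists pick : Ball n -> Vec n,
  forall w, supp mu (fst w) -> 0 < snd w ->
    supp mu (pick w) /\ dist (fst w) (pick w) <= snd w / 2 /\
    (snd w < rho0 -> good_move (fst w) (snd w) (pick w)).
Proof.
  apply (functional_choice (fun (w : Ball n) x' => supp mu (fst w) -> 0 < snd w ->
    supp mu x' /\ dist (fst w) x' <= snd w / 2 /\
    (snd w < rho0 -> good_move (fst w) (snd w) x'))).
  intros [x rho]; simpl.
  destruct (classic (supp mu x /\ 0 < rho < rho0)) as [[Hx Hrho]|Hno].
  - destruct (good_move_exists x rho Hx Hrho) as [x' Hx']; exists x'; tauto.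
  - exists x; intros Hx Hrho; rewrite dist_refl; repeat split; [exact Hx | lra | tauto].
Qed.

Lemma avoids_hyperplanes_ab_winning : ab_winning (supp mu) (avoids_hyperplanes z) alpha beta.
Proof.
  assert (Hab : 0 < alpha * beta < 1) by nra.
  destruct good_strategy_exists as [pick Hpick].
  apply (positional_strategy_wins (supp mu) _ alpha beta pick); try lra.
  - intros w Hw Hrad; destruct (Hpick w Hw Hrad) as [Hsupp [Hdist _]]; split; [exact Hsupp | nra].
  - intros b Hplay y Hy.
    destruct (play_small_radius _ _ _ _ _ (rho0 / 2) Hab ltac:(lra) Hplay) as [t Ht].
    apply (play_tail _ _ _ _ _ t) in Hplay; set (b' := fun k => b (t + k)%nat) in Hplay.
    assert (Hrad : forall k, snd (b' k) = snd (b' O) * (alpha * beta) ^ k)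
      by (intros k; apply (play_radius _ _ _ _ _ _ Hplay)).
    assert (Hpos : 0 < snd (b' O)) by apply (Hplay O).
    destruct (play_potential_bounded (supp mu) pick b' Hplay) as [D Hpot].
    + intros k; destruct (Hplay k) as [Hsupp [Hposk _]]; apply Hpick; auto.
      apply Rle_lt_trans with (snd (b' O)); [|unfold b'; rewrite Nat.add_0_r; lra].
      rewrite Hrad; assert (Hpow : (alpha * beta) ^ k <= 1 ^ k) by (apply pow_incr; lra).
      rewrite pow1 in Hpow; nra.
    + apply (potential_bound_avoids (alpha * beta) D
               (fun k => fst (b' k)) (fun k => snd (b' k)) y); auto.
      intros k; apply (Hy (t + k)%nat).
Qed.

End HyperplaneGame.

Theorem avoids_hyperplanes_winning {n : nat} (mu : (Vec n -> Prop) -> ER) (rho0 alpha kappa : R)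
  (z : nat -> Vec n) :
  is_borel_measure mu -> 0 < rho0 -> 0 < alpha <= 1 / 4 ->
  thin_slabs mu (1 / 4) (4 * alpha) rho0 ->
  0 < kappa -> (forall j, 2 ^ j <= 2 * norm (z j)) -> (forall j, norm (z j) <= kappa * 2 ^ j) ->
  alpha_winning (supp mu) (avoids_hyperplanes z) alpha.
Proof.
  intros Hmu Hrho0 Ha Hthin Hkappa Hlower Hupper beta Hb.
  destruct (ex_Rpower_neg_eq_2 (alpha * beta)) as [s [Hs Hdouble]]; [nra|].
  apply (avoids_hyperplanes_ab_winning n z s) with (kappa := kappa) (rho0 := rho0); auto.
Qed.

(** * Dirichlet's theorem and best approximations in dyadic shells *)

Fixpoint list_funs {A : Type} (l : list A) (n : nat) : list (Fin.t n -> A) :=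
  match n with
  | O => (fun i => Fin.case0 (fun _ => A) i) :: nil
  | S m => map (fun p => fcons (fst p) (snd p)) (list_prod l (list_funs l m))
  end.

Lemma In_list_funs {A : Type} (l : list A) (n : nat) (f : Fin.t n -> A) :
  In f (list_funs l n) <-> forall i, In (f i) l.
Proof.
  induction n as [|n IH]; simpl.
  - split; [intros _ i; inversion i|].
    intros _; left; extensionality i; inversion i.
  - rewrite in_map_iff; split.
    + intros [[a g] [<- Hin]] i; apply in_prod_iff in Hin; destruct Hin as [Ha Hg].
      apply (Fin.caseS' i); simpl; [exact Ha | apply IH; exact Hg].
    + intros Hf; exists (f Fin.F1, fun i => f (Fin.FS i)); split; [apply fcons_eta|].
      apply in_prod; [apply Hf | apply IH; intros i; apply Hf].
Qed.

Lemma NoDup_list_prod {A B : Type} (l : list A) (l' : list B) :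
  NoDup l -> NoDup l' -> NoDup (list_prod l l').
Proof.
  intros Hl Hl'; induction Hl as [|a l Ha Hl IH]; simpl; [constructor|].
  apply NoDup_app; [|exact IH|].
  - apply FinFun.Injective_map_NoDup; [|exact Hl'].
    intros b b' Heq; congruence.
  - intros [a' b] Hhead Htail; apply in_map_iff in Hhead; destruct Hhead as [b' [Heq _]].
    apply in_prod_iff in Htail; destruct Htail as [Ha' _]; congruence.
Qed.

Lemma NoDup_list_funs {A : Type} (l : list A) (n : nat) : NoDup l -> NoDup (list_funs l n).
Proof.
  intros Hl; induction n as [|n IH]; simpl.
  - constructor; [intros [] | constructor].
  - apply FinFun.Injective_map_NoDup; [|apply NoDup_list_prod; assumption].
    intros [a f] [b g] Heq; f_equal.
    + exact (f_equal (fun h => h Fin.F1) Heq).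
    + extensionality i; exact (f_equal (fun h => h (Fin.FS i)) Heq).
Qed.

Lemma length_list_funs {A : Type} (l : list A) (n : nat) :
  length (list_funs l n) = (length l ^ n)%nat.
Proof.
  induction n as [|n IH]; simpl; [reflexivity|].
  rewrite length_map, length_prod, IH; reflexivity.
Qed.

Definition zvec {n : nat} (y : Fin.t n -> Z) : Vec n := fun i => IZR (y i).

Definition approximates {n m : nat} (B : Fin.t m -> Fin.t n -> R) (eps : R)
  (y : Fin.t n -> Z) : Prop :=
  exists P : Fin.t m -> Z, forall j, Rabs (matZ B y j - IZR (P j)) <= eps.

Lemma approximates_le {n m : nat} (B : Fin.t m -> Fin.t n -> R) (eps eps' : R)
  (y : Fin.t n -> Z) : eps <= eps' -> approximates B eps y -> approximates B eps' y.
Proof. intros Heps [P HP]; exists P; intros j; apply Rle_trans with (1 := HP j), Heps. Qed.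

Lemma matZ_sub {n m : nat} (B : Fin.t m -> Fin.t n -> R) (y y' : Fin.t n -> Z) (j : Fin.t m) :
  matZ B (fun i => y i - y' i)%Z j = matZ B y j - matZ B y' j.
Proof.
  unfold matZ; rewrite <- sumFin_minus; apply sumFin_ext; intros i; rewrite minus_IZR; ring.
Qed.

Lemma fractional_part_cell (N : nat) (v : R) : (0 < N)%nat ->
  exists c, (c < N)%nat /\ INR c <= (v - IZR (Zfloor v)) * INR N <= INR c + 1.
Proof.
  intros HN; assert (HN' : 0 < INR N) by (apply lt_0_INR, HN).
  pose proof (Zfloor_bound v) as Hv.
  set (u := (v - IZR (Zfloor v)) * INR N).
  assert (Hu : 0 <= u < INR N) by (unfold u; split; nra).
  pose proof (Zfloor_bound u) as Hfloor.
  assert (Hpos : (0 <= Zfloor u)%Z) by (apply Zfloor_lub; lra).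
  assert (Hc : INR (Z.to_nat (Zfloor u)) = IZR (Zfloor u))
    by (rewrite INR_IZR_INZ, Z2Nat.id by exact Hpos; reflexivity).
  exists (Z.to_nat (Zfloor u)); split; [apply INR_lt|]; rewrite Hc; lra.
Qed.

Lemma Dirichlet_linear_forms {n m : nat} (B : Fin.t m -> Fin.t n -> R) (N T : nat) :
  (0 < N)%nat -> (N ^ m < S T ^ n)%nat ->
  exists y : Fin.t n -> Z, (exists i, y i <> 0%Z) /\
    (forall i, (Z.abs (y i) <= Z.of_nat T)%Z) /\ approximates B (/ INR N) y.
Proof.
  intros HN Hcount.
  set (v := fun (y : Fin.t n -> nat) => matZ B (fun i => Z.of_nat (y i))).
  destruct (Permutation_pigeonhole_rel
    (l1 := list_funs (seq 0 (S T)) n) (l2 := list_funs (seq 0 N) m)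
    (fun (y : Fin.t n -> nat) (c : Fin.t m -> nat) =>
      forall j, INR (c j) <= (v y j - IZR (Zfloor (v y j))) * INR N <= INR (c j) + 1))
    as [y [y' [l [Hperm [c [_ [Hy Hy']]]]]]].
  - apply Forall_forall; intros y _; apply Exists_exists.
    destruct (functional_choice _ (fun j => fractional_part_cell N (v y j) HN)) as [c Hc].
    exists c; split; [|intros j; apply Hc].
    apply In_list_funs; intros j; apply in_seq; pose proof (proj1 (Hc j)); lia.
  - rewrite !length_list_funs, !length_seq; exact Hcount.
  - assert (Hnodup : NoDup (y :: y' :: l))
      by (apply (Permutation_NoDup Hperm), NoDup_list_funs, seq_NoDup).
    assert (Hrange : forall u, In u (y :: y' :: l) -> forall i, (u i <= T)%nat).
    { intros u Hu i; apply (Permutation_in _ (Permutation_sym Hperm)) in Hu.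
      rewrite In_list_funs in Hu; specialize (Hu i); apply in_seq in Hu; lia. }
    exists (fun i => Z.of_nat (y i) - Z.of_nat (y' i))%Z; repeat split.
    + apply not_all_ex_not; intros Hzero.
      apply NoDup_cons_iff in Hnodup; apply (proj1 Hnodup); left.
      extensionality i; specialize (Hzero i); lia.
    + intros i; pose proof (Hrange y (or_introl eq_refl) i).
      pose proof (Hrange y' (or_intror (or_introl eq_refl)) i); lia.
    + exists (fun j => Zfloor (v y j) - Zfloor (v y' j))%Z; intros j.
      rewrite matZ_sub, minus_IZR; fold (v y) (v y').
      assert (HN' : 0 < INR N) by (apply lt_0_INR, HN).
      specialize (Hy j); specialize (Hy' j).
      rewrite <- (Rmult_1_l (/ INR N)); apply Rle_div_r; [exact HN'|].
      rewrite <- (Rabs_right (INR N)) by lra; rewrite <- Rabs_mult.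
      apply Rabs_le; lra.
Qed.

Lemma ex_greatest_in_list {X : Type} (R : X -> X -> Prop) (S : X -> Prop) (l : list X) :
  (forall x y, R x y \/ R y x) -> (forall x y z, R x y -> R y z -> R x z) ->
  (forall x, In x l -> ~ S x) \/ exists z, S z /\ forall x, In x l -> S x -> R x z.
Proof.
  intros Htotal Htrans; induction l as [|a l IH]; [left; intros x []|].
  destruct (classic (S a)) as [Ha|Ha]; destruct IH as [Hnone|[z [Hz Hbest]]].
  - right; exists a; split; [exact Ha|]; intros x [<-|Hx] HSx.
    + destruct (Htotal a a); assumption.
    + destruct (Hnone x Hx HSx).
  - right; destruct (Htotal a z) as [Haz|Hza].
    + exists z; split; [exact Hz|]; intros x [<-|Hx] HSx; auto.
    + exists a; split; [exact Ha|]; intros x [<-|Hx] HSx; [|eauto].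
      destruct (Htotal a a); assumption.
  - left; intros x [<-|Hx]; auto.
  - right; exists z; split; [exact Hz|]; intros x [<-|Hx] HSx; [contradiction | auto].
Qed.

Definition shell {n : nat} (j : nat) (y : Fin.t n -> Z) : Prop :=
  (forall i, (Z.abs (y i) <= Z.of_nat (2 ^ j))%Z) /\
  exists i, (Z.of_nat (2 ^ j) <= 2 * Z.abs (y i))%Z.

Lemma shell_cover {n : nat} (k : nat) (y : Fin.t n -> Z) :
  (exists i, y i <> 0%Z) -> (forall i, (Z.abs (y i) <= Z.of_nat (2 ^ k))%Z) ->
  exists j, (j <= k)%nat /\ shell j y.
Proof.
  intros Hy; induction k as [|k IH]; intros Hk.
  - exists O; split; [lia|]; split; [exact Hk|].
    destruct Hy as [i Hi]; exists i; rewrite Nat.pow_0_r; lia.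
  - destruct (classic (exists i, (Z.of_nat (2 ^ S k) <= 2 * Z.abs (y i))%Z)) as [Hlarge|Hsmall].
    + exists (S k); repeat split; auto.
    + destruct IH as [j [Hj Hshell]]; [|exists j; split; [lia | exact Hshell]].
      intros i; apply Z.lt_le_incl, Z.nle_gt; intros Hle; apply Hsmall; exists i.
      rewrite Nat.pow_succ_r'; lia.
Qed.

Lemma shell_norm {n : nat} (j : nat) (y : Fin.t n -> Z) : shell j y ->
  2 ^ j <= 2 * norm (zvec y) /\ norm (zvec y) <= INR n * 2 ^ j.
Proof.
  assert (Hpow : IZR (Z.of_nat (2 ^ j)) = 2 ^ j) by (rewrite <- INR_IZR_INZ, pow_INR; reflexivity).
  intros [Hall [i Hi]]; rewrite <- Hpow; split.
  - apply Rle_trans with (2 * IZR (Z.abs (y i))).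
    + rewrite <- mult_IZR; apply IZR_le, Hi.
    + rewrite abs_IZR; pose proof (norm_ge_coord (zvec y) i) as Hcoord.
      unfold zvec at 1 in Hcoord; lra.
  - apply norm_le_coord; [apply IZR_le; lia|].
    intros k; unfold zvec; rewrite <- abs_IZR; apply IZR_le, Hall.
Qed.

Lemma shell_best_approximation {n m : nat} (B : Fin.t m -> Fin.t n -> R) (j : nat) :
  (1 <= n)%nat ->
  exists z, shell j z /\
    forall eps y, shell j y -> approximates B eps y -> approximates B eps z.
Proof.
  intros Hn; set (N := Z.of_nat (2 ^ j)).
  set (l := list_funs (map (fun k => Z.of_nat k - N)%Z (seq 0 (Z.to_nat (2 * N + 1)))) n).
  assert (Hl : forall y, shell j y -> In y l).
  { intros y [Hy _]; apply In_list_funs; intros i; apply in_map_iff.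
    specialize (Hy i); fold N in Hy.
    exists (Z.to_nat (y i + N)); split; [lia | apply in_seq; lia]. }
  destruct (ex_greatest_in_list
    (fun y z => forall eps, approximates B eps y -> approximates B eps z) (shell j) l)
    as [Hnone|[z [Hz Hbest]]].
  - intros x y; apply NNPP; intros Hno; apply not_or_and in Hno; destruct Hno as [Hxy Hyx].
    apply not_all_ex_not in Hxy; destruct Hxy as [eps Heps].
    apply not_all_ex_not in Hyx; destruct Hyx as [eps' Heps'].
    destruct (Rle_dec eps eps'); [apply Heps' | apply Heps]; intros Happ; exfalso.
    + apply Heps'; intros _; apply approximates_le with eps; tauto.
    + apply Heps; intros _; apply approximates_le with eps'; [lra | tauto].
  - eauto.
  - destruct n as [|n]; [lia|].
    assert (Hshell : @shell (S n) j (fun _ => N)) by (split; [|exists Fin.F1]; unfold N; lia).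
    destruct (Hnone _ (Hl _ Hshell) Hshell).
  - exists z; split; [exact Hz|]; intros eps y Hy; apply Hbest; auto.
Qed.

Lemma dyadic_ceiling (x : R) : 1 <= x -> exists k, x <= 2 ^ k <= 2 * x.
Proof.
  intros Hx; assert (Hinv : 0 < / x <= 1).
  { split; [apply Rinv_0_lt_compat; lra|].
    rewrite <- Rinv_1; apply Rinv_le_contravar; lra. }
  destruct (geometric_scale (/ 2) (/ x) 1) as [k [Hlow Hup]]; [lra | lra | lra |].
  rewrite Rmult_1_l, pow_inv in *; rewrite Rmin_left in Hlow by lra.
  assert (Hpow : 0 < / 2 ^ k) by (apply Rinv_0_lt_compat, pow_lt; lra).
  apply Rinv_le_contravar in Hlow; [|lra]; apply Rinv_le_contravar in Hup; [|exact Hpow].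
  rewrite Rinv_mult, !Rinv_inv in *; exists k; lra.
Qed.

Lemma Dirichlet_real {n m : nat} (B : Fin.t m -> Fin.t n -> R) (X : R) :
  (1 <= n)%nat -> 1 <= X ->
  exists k y, 2 ^ k <= 2 * Rpower (2 * X) (INR m / INR n) /\ (exists i, y i <> 0%Z) /\
    (forall i, (Z.abs (y i) <= Z.of_nat (2 ^ k))%Z) /\ approximates B (/ X) y.
Proof.
  intros Hn HX; set (N := Z.to_nat (Zceil X)); set (e := INR m / INR n).
  assert (Hn' : 0 < INR n) by (apply lt_0_INR; lia).
  assert (He : 0 <= e) by (apply Rdiv_le_0_compat; [apply pos_INR | exact Hn']).
  pose proof (Zceil_bound X) as Hceil.
  assert (HZ : (0 < Zceil X)%Z) by (apply lt_IZR; lra).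
  assert (HN : INR N = IZR (Zceil X))
    by (unfold N; rewrite INR_IZR_INZ, Z2Nat.id by lia; reflexivity).
  assert (HNe : 1 <= Rpower (INR N) e)
    by (rewrite <- (Rpower_O (INR N)) by lra; apply Rle_Rpower; lra).
  destruct (dyadic_ceiling _ HNe) as [k [Hlow Hup]].
  destruct (Dirichlet_linear_forms B N (2 ^ k)) as [y [Hy [Hbound Happ]]].
  - unfold N; lia.
  - apply Nat.le_lt_trans with ((2 ^ k) ^ n)%nat; [|apply Nat.pow_lt_mono_l; lia].
    apply INR_le; rewrite !pow_INR; change (INR 2) with 2.
    apply Rle_trans with (Rpower (INR N) e ^ n); [|apply pow_incr; lra].
    rewrite <- !Rpower_pow by (try apply exp_pos; lra).
    rewrite Rpower_mult; apply Req_le; f_equal; unfold e; field; lra.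
  - exists k, y; repeat split; auto.
    + apply Rle_trans with (1 := Hup), Rmult_le_compat_l; [lra|].
      apply Rle_Rpower_l; [exact He | lra].
    + apply approximates_le with (2 := Happ), Rinv_le_contravar; lra.
Qed.

Lemma best_approximation_sequence {n m : nat} (B : Fin.t m -> Fin.t n -> R) : (1 <= n)%nat ->
  exists z : nat -> Fin.t n -> Z, (forall j, shell j (z j)) /\
    forall X, 1 <= X -> exists j,
      norm (zvec (z j)) <= 2 * INR n * Rpower (2 * X) (INR m / INR n) /\
      approximates B (/ X) (z j).
Proof.
  intros Hn.
  destruct (functional_choice _ (fun j => shell_best_approximation B j Hn)) as [z Hz].
  exists z; split; [intros j; apply Hz|]; intros X HX.
  destruct (Dirichlet_real B X Hn HX) as [k [y [Hk [Hy [Hbound Happ]]]]].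
  destruct (shell_cover k y Hy Hbound) as [j [Hjk Hj]].
  exists j; split; [|apply (proj2 (Hz j) _ y); assumption].
  apply Rle_trans with (INR n * 2 ^ j); [apply shell_norm, Hz|].
  assert (Hpow : 2 ^ j <= 2 ^ k) by (apply Rle_pow; [lra | exact Hjk]).
  rewrite (Rmult_comm 2), Rmult_assoc; apply Rmult_le_compat_l; [apply pos_INR | lra].
Qed.

(** * Transference *)

Definition transpose {n m : nat} (A : Fin.t n -> Fin.t m -> R) : Fin.t m -> Fin.t n -> R :=
  fun j i => A i j.

Lemma dot_matZ_transpose {n m : nat} (A : Fin.t n -> Fin.t m -> R) (q : Fin.t m -> Z)
  (y : Fin.t n -> Z) : dot (zvec y) (matZ A q) = dot (zvec q) (matZ (transpose A) y).
Proof.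
  unfold dot, matZ, zvec, transpose.
  transitivity (sumFin n (fun i => sumFin m (fun j => IZR (q j) * (A i j * IZR (y i))))).
  - apply sumFin_ext; intros i; rewrite <- sumFin_scal; apply sumFin_ext; intros j; ring.
  - rewrite sumFin_swap; apply sumFin_ext; intros j; apply sumFin_scal.
Qed.

Lemma dot_zvec_integer {n : nat} (y p : Fin.t n -> Z) : exists N, dot (zvec y) (zvec p) = IZR N.
Proof.
  unfold dot, zvec; induction n as [|n IH]; simpl; [exists 0%Z; reflexivity|].
  destruct (IH (fun i => y (Fin.FS i)) (fun i => p (Fin.FS i))) as [N HN].
  exists (y Fin.F1 * p Fin.F1 + N)%Z; rewrite HN, plus_IZR, mult_IZR; reflexivity.
Qed.

Lemma transference_identity {n m : nat} (A : Fin.t n -> Fin.t m -> R) (x : Vec n)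
  (q P : Fin.t m -> Z) (p y : Fin.t n -> Z) :
  exists N : Z, dot (zvec y) x - IZR N =
    dot (zvec q) (vsub (matZ (transpose A) y) (zvec P))
    - dot (zvec y) (vsub (vsub (matZ A q) x) (zvec p)).
Proof.
  destruct (dot_zvec_integer q P) as [N HN]; destruct (dot_zvec_integer y p) as [N' HN'].
  exists (N - N')%Z; rewrite minus_IZR, <- HN, <- HN', !dot_sub_r, (dot_matZ_transpose A q y); ring.
Qed.

Lemma transference {n m : nat} (A : Fin.t n -> Fin.t m -> R) (x : Vec n) (q : Fin.t m -> Z)
  (p y : Fin.t n -> Z) (eps delta : R) :
  approximates (transpose A) eps y -> 0 <= eps -> INR m * eps * znorm q <= delta / 2 ->
  (forall N : Z, delta <= Rabs (dot (zvec y) x - IZR N)) ->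
  delta / 2 <= norm (zvec y) * dist (vsub (matZ A q) x) (zvec p).
Proof.
  intros [P HP] Heps Hsmall Havoid.
  destruct (transference_identity A x q P p y) as [N HN].
  specialize (Havoid N); rewrite HN in Havoid.
  assert (Hq : Rabs (dot (zvec q) (vsub (matZ (transpose A) y) (zvec P))) <= delta / 2).
  { apply Rle_trans with (1 := Cauchy_Schwarz _ _), Rle_trans with (2 := Hsmall).
    rewrite Rmult_comm; apply Rmult_le_compat_r; [apply norm_nonneg|].
    apply norm_le_coord; [exact Heps | exact HP]. }
  pose proof (Cauchy_Schwarz (zvec y) (vsub (vsub (matZ A q) x) (zvec p))) as Hy.
  rewrite <- dist_norm in Hy.
  pose proof (Rabs_triang (dot (zvec q) (vsub (matZ (transpose A) y) (zvec P)))
    (- dot (zvec y) (vsub (vsub (matZ A q) x) (zvec p)))) as Htri.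
  rewrite Rabs_Ropp in Htri; unfold Rminus in Havoid; lra.
Qed.

Lemma znorm_ge_1 {m : nat} (q : Fin.t m -> Z) : (exists j, q j <> 0%Z) -> 1 <= znorm q.
Proof.
  intros [j Hj]; apply Rle_trans with (Rabs (zvec q j)); [|apply (norm_ge_coord (zvec q))].
  unfold zvec; rewrite <- abs_IZR; apply IZR_le; lia.
Qed.

Lemma Bad_of_avoids_hyperplanes {n m : nat} (A : Fin.t n -> Fin.t m -> R)
  (z : nat -> Fin.t n -> Z) (x : Vec n) :
  (1 <= n)%nat ->
  (forall X, 1 <= X -> exists j,
     norm (zvec (z j)) <= 2 * INR n * Rpower (2 * X) (INR m / INR n) /\
     approximates (transpose A) (/ X) (z j)) ->
  avoids_hyperplanes (fun j => zvec (z j)) x -> Bad n m A x.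
Proof.
  intros Hn Hz [delta [Hdelta Havoid]]; set (e := INR m / INR n) in *.
  assert (Hn' : 0 < INR n) by (apply lt_0_INR; lia).
  set (c := 2 * INR m / delta + 1).
  assert (Hc : 1 <= c).
  { assert (0 <= 2 * INR m / delta)
      by (apply Rdiv_le_0_compat; [pose proof (pos_INR m); lra | exact Hdelta]).
    unfold c; lra. }
  set (G := 2 * INR n * Rpower (2 * c) e).
  assert (HG : 0 < G) by (repeat apply Rmult_lt_0_compat; try apply exp_pos; lra).
  exists (delta / 2 / G); split; [apply Rdiv_lt_0_compat; lra|].
  intros q Hq p; pose proof (znorm_ge_1 q Hq) as HQ.
  destruct (Hz (c * znorm q)) as [j [Hnorm Happ]]; [nra|].
  apply Rle_div_l; [exact HG|].
  apply Rle_trans with (norm (zvec (z j)) * dist (vsub (matZ A q) x) (zvec p)).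
  - apply transference with (1 := Happ); [ | | apply Havoid].
    + apply Rlt_le, Rinv_0_lt_compat; nra.
    + replace (INR m * / (c * znorm q) * znorm q) with (INR m / c) by (field; lra).
      apply Rle_div_l; [lra|].
      replace (delta / 2 * c) with (INR m + delta / 2) by (unfold c; field; lra); lra.
  - change (dist (fun i => matZ A q i - x i) (fun i => IZR (p i)))
      with (dist (vsub (matZ A q) x) (zvec p)).
    rewrite <- Rmult_assoc, <- Rpower_mult_distr in Hnorm by lra.
    rewrite (Rmult_comm (_ * dist _ _)), <- Rmult_assoc.
    apply Rmult_le_compat_r; [apply dist_nonneg|].
    unfold G; rewrite Rmult_assoc; exact Hnorm.
Qed.

Lemma alpha_winning_mono {n : nat} (K T T' : Vec n -> Prop) (alpha : R) :
  (forall x, T x -> T' x) -> alpha_winning K T alpha -> alpha_winning K T' alpha.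
Proof.
  intros HT Hwin beta Hb; destruct (Hwin beta Hb) as [s Hs]; exists s; intros b.
  destruct (Hs b) as [Hlegal Houtcome]; split; [exact Hlegal|].
  intros Hl y Hy; destruct (Houtcome Hl y Hy); auto.
Qed.

Theorem corollary1p4 :
  forall (n : nat), (1 <= n)%nat ->
  forall (mu : (Vec n -> Prop) -> ER),
    is_borel_measure mu -> locally_finite mu -> abs_decaying mu ->
    exists alpha : R, 0 < alpha < 1 /\
      forall (m : nat) (A : Fin.t n -> Fin.t m -> R),
        alpha_winning (supp mu) (Bad n m A) alpha.
Proof.
  intros n Hn mu Hmu _ Hdecay.
  destruct (abs_decaying_thin_slabs mu (1 / 4) Hmu Hdecay) as [a [rho0 [Ha [Hrho0 Hthin]]]];
    [lra|].
  exists (a / 4); split; [lra|]; intros m A.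
  destruct (best_approximation_sequence (transpose A) Hn) as [z [Hshell Hz]].
  apply alpha_winning_mono with (avoids_hyperplanes (fun j => zvec (z j))).
  - intros x; apply Bad_of_avoids_hyperplanes; assumption.
  - apply (avoids_hyperplanes_winning mu rho0 (a / 4) (INR n)); auto; try lra.
    + replace (4 * (a / 4)) with a by field; exact Hthin.
    + apply lt_0_INR; lia.
    + intros j; apply shell_norm, Hshell.
    + intros j; apply shell_norm, Hshell.
Qed.
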